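(* Let $n\ge 3$. A transform $\mathcal Z:\mathrm{Conv}_{sc}(\mathbb R^n)\to F(\mathbb R^n;\mathbb R)$ is a continuous and $\mathrm{SL}(n)$ contravariant valuation such that there exist $\varepsilon\in\mathbb R$ and a function $\mathcal A:\mathbb R^n\to\mathbb R^n$ for which $$\mathcal Z(\tau_y u)=\mathcal Z(u)+\ell_{\mathcal A(y)},\qquad \mathcal Z(u+\ell_y)=\tau_{\varepsilon y}\mathcal Z(u)$$ for every $u\in \mathrm{Conv}_{sc}(\mathbb R^n)$ and $y\in\mathbb R^n$, if and only if there are constants $c,c',\sigma\in\mathbb R$ such that $\mathcal A y=\sigma y$ for every $y\in\mathbb R^n$ and $$\mathcal Z u(x)=\begin{cases}\varepsilon\sigma\,u^\ast(x/\varepsilon)+c,&\varepsilon\ne0,\\ c'\delta_x^0+c,&\varepsilon=0,\end{cases}$$ for every $u\in \mathrm{Conv}_{sc}(\mathbb R^n)$ and $x\in\mathbb R^n$.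
   Context: $\mathrm{Conv}_{sc}(\mathbb R^n)$ is the set of all lower semi-continuous convex functions $u:\mathbb R^n\to\mathbb R\cup\{\infty\}$ that are proper ($u\not\equiv\infty$) and super-coercive ($\lim_{|x|\to\infty} u(x)/|x|=\infty$). $F(\mathbb R^n;\mathbb R)$ is the set of all functions $\mathbb R^n\to\mathbb R$. The Legendre transform is $u^\ast(x)=\sup_{y\in\mathbb R^n}(x\cdot y-u(y))$. $\delta_x^0$ equals $1$ if $x=o$ (the origin) and $0$ otherwise. $u\vee v$ and $u\wedge v$ denote pointwise maximum and minimum. $\mathcal Z$ is a valuation if $\mathcal Z(u\vee v)+\mathcal Z(u\wedge v)=\mathcal Z u+\mathcal Z v$ whenever $u,v,u\vee v,u\wedge v\in \mathrm{Conv}_{sc}(\mathbb R^n)$. $\mathcal Z$ is continuous if epi-convergence $u_i\to u$ in $\mathrm{Conv}_{sc}(\mathbb R^n)$ implies $\mathcal Z u_i\to\mathcal Z u$ pointwise. Epi-convergence $u_i\to u$ means: for every $x\in\mathbb R^n$, $u(x)\le\liminf_i u_i(x_i)$ for all $x_i\to x$, and there is a sequence $x_i\to x$ with $u(x)=\lim_i u_i(x_i)$. $\mathcal Z$ is $\mathrm{SL}(n)$ contravariant if $\mathcal Z(u\circ\phi^{-1})=(\mathcal Z u)\circ\phi^{t}$ for all $u\in \mathrm{Conv}_{sc}(\mathbb R^n)$ and all $\phi\in \mathrm{SL}(n)$. For $y\in\mathbb R^n$, $\tau_y f(x)=f(x-y)$ and $\ell_y(x)=x\cdot y$. *)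

(* Defs.v *)
From HB Require Import structures.
From mathcomp Require Import all_boot all_order all_algebra.
From mathcomp Require Import all_classical all_reals all_analysis.

Set Implicit Arguments.
Unset Strict Implicit.
Unset Printing Implicit Defensive.

Import Order.TTheory GRing.Theory Num.Theory.
Import numFieldNormedType.Exports.

Local Open Scope classical_set_scope.
Local Open Scope ring_scope.
Local Open Scope ereal_scope.

Section euclidean_space.
Context {R : realType} {n : nat}.
Implicit Types (x y : 'rV[R]_n) (A : 'M[R]_n).

Definition dot x y : R := (\sum_i x ord0 i * y ord0 i)%R.

(* The library norm on 'rV[R]_n is the sup norm; it only provides the topology
   here. *)
Definition enorm x : R := Num.sqrt (dot x x).

(* Points are row vectors: the column A x is the row x A^T. *)
Definition mxact A x : 'rV[R]_n := (x *m A^T)%R.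

Definition translate (T : Type) y (f : 'rV[R]_n -> T) : 'rV[R]_n -> T :=
  fun x => f (x - y)%R.

Definition ell y : 'rV[R]_n -> R := fun x => dot x y.

Definition delta0 x : R := ((x == 0)%:R)%R.

End euclidean_space.

Section convex_functions.
Context {R : realType} {n : nat}.
Implicit Types u : 'rV[R]_n -> \bar R.

(* For -oo-free u, the endpoint cases t = 0 and t = 1 are harmless because
   0 * +oo = 0 in \bar R. *)
Definition convex_ereal u := forall (x y : 'rV[R]_n) (t : R),
  (0 <= t <= 1)%R ->
  u (t *: x + (1 - t) *: y)%R <= t%:E * u x + (1 - t)%R%:E * u y.

Definition super_coercive u := forall M : R, exists r : R,
  forall x, (r < enorm x)%R -> M%:E <= u x / (enorm x)%:E.

Definition Conv_sc : set ('rV[R]_n -> \bar R) := [set u |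
  [/\ forall x, u x != -oo,
      lower_semicontinuous u,
      convex_ereal u,
      exists x, u x != +oo
    & super_coercive u]].

Definition legendre u : 'rV[R]_n -> \bar R :=
  fun x => ereal_sup (range (fun y => (dot x y)%:E - u y)).

Definition epi_cvg (u_ : nat -> 'rV[R]_n -> \bar R) u :=
  forall x : 'rV[R]_n,
    (forall x_ : nat -> 'rV[R]_n, x_ @ \oo --> x ->
       u x <= limn_einf (fun i => u_ i (x_ i))) /\
    (exists2 x_ : nat -> 'rV[R]_n, x_ @ \oo --> x &
       (fun i => u_ i (x_ i)) @ \oo --> u x).

End convex_functions.

(* A transform Conv_sc -> F(R^n; R) is represented by a function on all
   extended-real-valued functions; every property below only involves its
   values on Conv_sc. *)
Definition transform (R : realType) (n : nat) : Type :=
  ('rV[R]_n -> \bar R) -> ('rV[R]_n -> R).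

Section transforms.
Context {R : realType} {n : nat}.
Implicit Types Z : transform R n.

Definition valuation Z := forall u v : 'rV[R]_n -> \bar R,
  Conv_sc u -> Conv_sc v -> Conv_sc (u \max v) -> Conv_sc (u \min v) ->
  forall x, (Z (u \max v) x + Z (u \min v) x = Z u x + Z v x)%R.

Definition epi_continuous Z :=
  forall (u_ : nat -> 'rV[R]_n -> \bar R) (u : 'rV[R]_n -> \bar R),
    (forall i, Conv_sc (u_ i)) -> Conv_sc u -> epi_cvg u_ u ->
    forall x, (fun i => Z (u_ i) x) @ \oo --> Z u x.

Definition SL_contravariant Z := forall u, Conv_sc u ->
  forall phi : 'M[R]_n, (\det phi = 1)%R ->
  forall x, Z (u \o mxact (invmx phi)) x = Z u (mxact phi^T x).

Definition translation_equations Z (eps : R) (A : 'rV[R]_n -> 'rV[R]_n) :=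
  forall u, Conv_sc u -> forall y x : 'rV[R]_n,
    (Z (translate y u) x = Z u x + ell (A y) x)%R /\
    Z (fun z => u z + (ell y z)%:E) x = translate (eps *: y)%R (Z u) x.

(* The equation lives in \bar R because legendre does; its values at members of
   Conv_sc are finite. *)
Definition representation Z (eps sigma c c' : R) :=
  forall u, Conv_sc u -> forall x : 'rV[R]_n,
    (Z u x)%:E =
    if eps != 0%R
    then (eps * sigma)%R%:E * legendre u (eps^-1 *: x)%R + c%:E
    else (c' * delta0 x + c)%R%:E.

End transforms.

(* Main.v *)
Require Import Defs.
From HB Require Import structures.
From mathcomp Require Import all_boot all_order all_algebra.
From mathcomp Require Import all_classical all_reals all_analysis.
From mathcomp Require Import ring lra.

(** The equation [A (phi y) = phi (A y)], forced by contravariance, makes [A] a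
    multiple [sigma] of the identity. Evaluating [Z] at [translate y u + ell z]
    in both orders then gives [Z (u + t) = Z u - eps * sigma * t] for constants
    [t], and each half of the classification becomes a statement on
    real-valued continuous valuations.

    If [eps = 0], then [V u = Z u x] is invariant under adding any affine
    function. Cutting the domain along a hyperplane [f = 0] shows that
    [u + k |f|] has the same value as [u], since on either side of the
    hyperplane the added term is affine; for [k] going to infinity this sequence
    epi-converges to the restriction of [u] to the hyperplane. Restricting
    coordinate by coordinate, [V u] is the value of [V] at the indicator of any
    single point of the domain of [u] (affine_invariant_point). Comparing two
    points of one domain gives [sigma = 0], and contravariance makes [Z u x]
    constant on nonzero [x].

    If [eps <> 0], the functional [V u = Z u 0 + eps * sigma * min u] is
    invariant under [SL(n)], translations and adding constants, and it has to be
    constant. When the domain of [u] lies in a hyperplane, there are maps of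
    determinant one that stretch this hyperplane by [k]; up to a translation and
    a constant they push [u] to the indicator of one point, so [V u] is the
    value of [V] there (valuation_hyperplane). Subtracting this value leaves
    an excess that is additive under hyperplane cuts. For an affine function on
    a simplex the excess depends only on the volume and on the values at the vertices.
    Cutting an edge between two vertices of equal value shows that it is halved
    when the volume is, hence it is the average of the excesses obtained by
    replacing one of two vertex values by their midpoint (excess_midpoint).
    Iterating makes the values almost equal, so by continuity the excess does
    not depend on them (excess_affine_cst); sending one value to infinity
    collapses the function onto a facet, so the excess is zero
    (excess_affine0). Maxima of finitely many affine functions on a simplex
    reduce to the affine case by cutting edges where two of the functions agree
    (excess0), and they are dense for epi-convergence (constant_of_pwaff).

    The converse direction rests on the equality of the Legendre transform at
    [x] with minus the minimum of [u - ell x], and on the continuity and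
    valuation property of the minimum (minval_cvg, minval_valuation). *)

Set Implicit Arguments.
Unset Strict Implicit.
Unset Printing Implicit Defensive.

Import Order.TTheory GRing.Theory Num.Theory.
Import numFieldNormedType.Exports.

Local Open Scope classical_set_scope.
Local Open Scope ring_scope.

(** * Norms and the inner product *)

Lemma ler_sum_bound {R : realType} {n : nat} (f : 'I_n -> R) (c : R) :
  (forall i, f i <= c) -> \sum_i f i <= n%:R * c.
Proof.
move=> fc; apply: (@le_trans _ _ (\sum_(i < n) c)); first exact: ler_sum.
by rewrite sumr_const card_ord mulr_natl.
Qed.

Section norms.
Context {R : realType} {n : nat}.
Implicit Types x y z : 'rV[R]_n.

Lemma coord_le_norm x i : `|x ord0 i| <= `|x|.
Proof.
rewrite [leRHS]/Num.norm /= mx_normrE; apply/bigmax_geP; right => /=.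
by exists (ord0, i).
Qed.

Lemma norm_le_coord x r : 0 <= r -> (forall i, `|x ord0 i| <= r) -> `|x| <= r.
Proof.
move=> r0 xr; rewrite [leLHS]/Num.norm /= mx_normrE; apply/bigmax_leP; split=> //.
by case=> i j _ /=; rewrite ord1.
Qed.

Lemma dotC x y : dot x y = dot y x.
Proof. by apply: eq_bigr => i _; rewrite mulrC. Qed.

Lemma dotDl x y z : dot (x + y) z = dot x z + dot y z.
Proof. by rewrite -big_split /=; apply: eq_bigr => i _; rewrite mxE mulrDl. Qed.

Lemma dotZl (a : R) x y : dot (a *: x) y = a * dot x y.
Proof. by rewrite mulr_sumr; apply: eq_bigr => i _; rewrite mxE mulrA. Qed.

Lemma dotNl x y : dot (- x) y = - dot x y.
Proof. by rewrite -scaleN1r dotZl mulN1r. Qed.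

Lemma dotDr x y z : dot z (x + y) = dot z x + dot z y.
Proof. by rewrite !(dotC z) dotDl. Qed.

Lemma dotZr (a : R) x y : dot y (a *: x) = a * dot y x.
Proof. by rewrite !(dotC y) dotZl. Qed.

Lemma dotNr x y : dot y (- x) = - dot y x.
Proof. by rewrite !(dotC y) dotNl. Qed.

Lemma dot0r x : dot x 0 = 0.
Proof. by apply: big1 => i _; rewrite mxE mulr0. Qed.

Lemma dot_ge0 x : 0 <= dot x x.
Proof. by apply: sumr_ge0 => i _; rewrite -expr2 sqr_ge0. Qed.

Lemma dot_le_norm x y : `|dot x y| <= n%:R * `|y| * `|x|.
Proof.
apply: le_trans (ler_norm_sum _ _ _) _.
rewrite -mulrA; apply: ler_sum_bound => i.
by rewrite normrM mulrC ler_pM// coord_le_norm.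
Qed.

Lemma norm_le_enorm x : `|x| <= enorm x.
Proof.
apply: norm_le_coord; first exact: sqrtr_ge0.
move=> i; rewrite -sqrtr_sqr ler_sqrt ?dot_ge0 // /dot (bigD1 i) //=.
by rewrite expr2 lerDl; apply: sumr_ge0 => j _; rewrite -expr2 sqr_ge0.
Qed.

Lemma normsq_le_dot x : `|x| ^+ 2 <= dot x x.
Proof.
by rewrite -(sqr_sqrtr (dot_ge0 x)) lerXn2r ?nnegrE ?sqrtr_ge0// norm_le_enorm.
Qed.

Lemma enorm_le_norm x : enorm x <= n.+1%:R * `|x|.
Proof.
have x0 : 0 <= n.+1%:R * `|x| :> R by rewrite mulr_ge0.
rewrite -(ger0_norm x0) -sqrtr_sqr ler_sqrt ?sqr_ge0//.
apply: le_trans (ler_norm _) _; apply: le_trans (dot_le_norm _ _) _.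
rewrite exprMn -mulrA -expr2 ler_wpM2r ?sqr_ge0// -natrX ler_nat.
by rewrite (leq_trans (leqnSn n))// expnS leq_pmulr.
Qed.

Lemma lipschitz_norm_continuous (W : pseudoMetricNormedZmodType R)
    (f : 'rV[R]_n -> W) (C : R) :
  (forall x y, `|f x - f y| <= C * `|x - y|) -> continuous f.
Proof.
move=> fC x; apply/(@cvgrPdist_lt _ _ _ (nbhs x) (nbhs_filter x)) => /= e e0.
have C0 : 0 < `|C| + 1 by rewrite ltr_pwDr.
have de : 0 < e / (`|C| + 1) by rewrite divr_gt0.
have := nbhsx_ballx x _ de; rewrite -ball_normE /=.
apply: filterS => y /= xy; apply: le_lt_trans (fC _ _) _.
apply: (@le_lt_trans _ _ ((`|C| + 1) * `|x - y|)).
  by rewrite ler_wpM2r// (le_trans (ler_norm _))// lerDl.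
by rewrite mulrC -ltr_pdivlMr.
Qed.

Lemma dot_continuous z : continuous (fun x => dot x z).
Proof.
apply: (@lipschitz_norm_continuous _ _ (n%:R * `|z|)) => x y.
by rewrite -dotNl -dotDl dot_le_norm.
Qed.

Lemma dist_continuous z : continuous (fun x => dot (x - z) (x - z)).
Proof.
have xz : (fun x => dot (x - z) (x - z)) =
    (fun x => \sum_(i < n) (x ord0 i - z ord0 i) * (x ord0 i - z ord0 i)).
  by apply/funext => x; apply: eq_bigr => i _; rewrite !mxE.
rewrite xz.
have H := @continuous_big R 'I_n +%R 0 xpredT (@add_continuous R) 'rV[R]_n
  (index_enum 'I_n)
  (fun i x => (x ord0 i - z ord0 i) * (x ord0 i - z ord0 i)).
refine (H _) => i _ x.
apply: (@continuous_comp _ _ _ (fun x => x ord0 i - z ord0 i) (fun y : R => y * y)).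
  apply: (@lipschitz_norm_continuous _ _ 1) => a b; rewrite mul1r.
  have -> : a ord0 i - z ord0 i - (b ord0 i - z ord0 i) = (a - b) ord0 i.
    by rewrite !mxE; ring.
  exact: coord_le_norm.
by apply: cvgM; exact: cvg_id.
Qed.

Lemma ball_compact (r : R) : compact [set x : 'rV[R]_n | `|x| <= r].
Proof.
apply: bounded_closed_compact.
  exists r; split; first exact: num_real.
  by move=> M rM x /= xr; rewrite (le_trans xr)// ltW.
have -> : [set x : 'rV[R]_n | `|x| <= r] = Num.norm @^-1` [set y | y <= r] by [].
apply: closed_comp; last exact: closed_le.
by move=> x _; exact: norm_continuous.
Qed.

Lemma norm_mulmx m (x : 'rV[R]_n) (Q : 'M[R]_(n, m)) :
  `|x *m Q| <= (n%:R * `|Q|) * `|x|.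
Proof.
have Q0 : 0 <= n%:R * `|Q| * `|x| by rewrite !mulr_ge0.
rewrite [leLHS]/Num.norm /= mx_normrE; apply/bigmax_leP; split=> //.
case=> i j _ /=; rewrite ord1 mxE; apply: le_trans (ler_norm_sum _ _ _) _.
rewrite -mulrA; apply: ler_sum_bound => k.
rewrite normrM mulrC ler_pM ?coord_le_norm//.
rewrite [leRHS]/Num.norm /= mx_normrE; apply/bigmax_geP; right => /=.
by exists (k, j).
Qed.

End norms.

(** * Super-coercive convex functions and their stability *)

Section conv_sc.
Local Open Scope ereal_scope.
Context {R : realType} {n : nat}.
Implicit Types (u v : 'rV[R]_n -> \bar R) (x y z : 'rV[R]_n).

(** Super-coercivity as a family of linear lower bounds that hold on the
    whole space. This form passes through changes of variables, sums and
    restrictions at once. *)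
Definition growth u := forall M : R, exists b : R,
  forall x, (M * `|x| + b)%:E <= u x.

Lemma lscP u : lower_semicontinuous u <->
  forall x (a : R), a%:E < u x -> \forall y \near x, a%:E < u y.
Proof.
split=> ulsc x a /ulsc; last by exists [set y | a%:E < u y].
by move=> [A xA Au]; apply: filterS xA.
Qed.

(** The finite subcover argument for sequences; it takes the place of extracting
    convergent subsequences. *)
Lemma compact_eventually (K : set 'rV[R]_n) (P : nat -> 'rV[R]_n -> Prop) :
  compact K ->
  (forall x, K x -> exists A N, nbhs x A /\
     forall y k, A y -> (N <= k)%N -> P k y) ->
  exists N, forall k, (N <= k)%N -> forall x, K x -> P k x.
Proof.
move=> /compact_near_coveringP cK locP.
have [x Kx|N _ NP] := cK nat \oo P _.
  have [A [N [xA AP]]] := locP x Kx.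
  exists (A, [set k | (N <= k)%N]); first by split=> //; exists N.
  by move=> [y k] [Ay Nk]; exact: AP.
by exists N => k Nk x Kx; exact: (NP k Nk x Kx).
Qed.

Lemma nat_gt (r : R) : exists k : nat, (r < k%:R)%R.
Proof. by exists (Num.truncn r).+1; exact: truncnS_gt. Qed.

Lemma lsc_bounded_below (K : set 'rV[R]_n) u : compact K ->
  lower_semicontinuous u -> (forall x, u x != -oo) ->
  exists b : R, forall x, K x -> b%:E <= u x.
Proof.
move=> cK /lscP ul uN.
have [x _|N uge] := compact_eventually (P := fun k y => (- k%:R)%R%:E < u y) cK.
  have [k ku] : exists k : nat, (- k%:R)%R%:E < u x.
    case: (u x) (uN x) => [r _|_|//]; last by exists 0%N; rewrite ltry.
    by have [k rk] := nat_gt (- r); exists k; rewrite lte_fin ltrNl.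
  exists [set y | (- k%:R)%R%:E < u y], k; split; first exact: ul.
  move=> y k' /= ky kk'; apply: le_lt_trans ky.
  by rewrite lee_fin lerN2 ler_nat.
by exists (- N%:R)%R => x Kx; exact/ltW/uge.
Qed.

(** If the infimum [m] were not attained, the open sets where [u] exceeds
    [m + 1/k] would cover [K], and finitely many of them would suffice. *)
Lemma lsc_min (K : set 'rV[R]_n) u : compact K -> lower_semicontinuous u ->
  K !=set0 -> (forall x, u x != -oo) ->
  exists2 x, K x & forall y, K y -> u x <= u y.
Proof.
move=> cK ul [x0 Kx0] uN; have [b ub] := lsc_bounded_below cK ul uN.
set m := ereal_inf (u @` K).
have mle y : K y -> m <= u y by move=> Ky; apply: ereal_inf_lbound; exists y.
have bm : b%:E <= m by apply: le_ereal_inf_tmp => _ [y Ky <-]; exact: ub.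
apply: contrapT => nmin.
have mlt y : K y -> m < u y.
  move=> Ky; rewrite lt_neqAle mle// andbT; apply/eqP => mu; apply: nmin.
  by exists y => // z Kz; rewrite -mu mle.
case mE : m bm => [r| |//] bm; last by have := mlt _ Kx0; rewrite mE ltNge leey.
have [x Kx|N uge] :=
    compact_eventually (P := fun k y => (r + k.+1%:R^-1)%:E < u y) cK.
  have [s rs sx] : exists2 s, (r < s)%R & s%:E < u x.
    have := mlt x Kx; rewrite mE; case: (u x) (uN x) => [t _|_ _|//].
      by rewrite lte_fin => rt; exists ((r + t) / 2)%R; rewrite ?lte_fin; lra.
    by exists (r + 1)%R; rewrite ?ltry//; lra.
  have [k ks] := nat_gt ((s - r)^-1)%R.
  exists [set y | s%:E < u y], k; split; first exact: (lscP u).1.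
  move=> y k' /= sy kk'; apply: le_lt_trans sy; rewrite lee_fin -lerBrDl.
  rewrite invf_ple ?posrE ?subr_gt0 ?ltr0Sn//; apply: le_trans (ltW ks) _.
  by rewrite ler_nat (leq_trans kk').
have /ereal_inf_lt[_ [y Ky <-]] : m < (r + N.+1%:R^-1)%:E.
  by rewrite mE lte_fin ltrDl invr_gt0 ltr0Sn.
by apply/negP; rewrite -leNgt; exact/ltW/uge.
Qed.

Lemma growth_noNy u : growth u -> forall x, u x != -oo.
Proof.
move=> gu x; have [b ub] := gu 0%R; apply/eqP => ux.
by have := ub x; rewrite ux leNgt ltNyr.
Qed.

(** Near infinity [growth] is super-coercivity; on the remaining ball a lower
    semi-continuous function is bounded below, which only costs a constant. *)
Lemma Conv_scP u : Conv_sc u <->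
  [/\ lower_semicontinuous u, convex_ereal u, (exists x, u x != +oo) & growth u].
Proof.
split=> [[uN ul uc up us]|[ul uc up ug]]; last first.
  split=> //; first exact: growth_noNy.
  move=> M; have [b ub] := ug ((`|M| + 1) * n.+1%:R)%R.
  exists `|b|%R => x xb; have x0 : (0 < enorm x)%R by exact: le_lt_trans xb.
  rewrite inver gt_eqF// lee_pdivlMr//.
  apply: le_trans (ub x); rewrite -EFinM lee_fin.
  apply: (@le_trans _ _ (`|M| * enorm x)%R).
    by rewrite ler_wpM2r ?sqrtr_ge0// ler_norm.
  have : ((`|M| + 1) * enorm x <= (`|M| + 1) * n.+1%:R * `|x|)%R.
    by rewrite -mulrA ler_wpM2l ?enorm_le_norm// addr_ge0.
  have := ler_norm (- b); rewrite normrN => bb.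
  move=> h; apply: le_trans (_ : _ <= (`|M| + 1) * enorm x + b)%R _; last first.
    by rewrite lerD2r.
  rewrite mulrDl mul1r -addrA lerDl; have := ltW xb; lra.
split=> // M; have [r0 ur0] := us `|M|%R; pose r := Num.max r0 0%R.
have [b0 ub0] := lsc_bounded_below (@ball_compact R n r) ul uN.
have r_ge0 : (0 <= r)%R by rewrite le_max lexx orbT.
exists (- (`|b0| + `|M| * r))%R => x.
have [xr|rx] := leP (enorm x) r.
  have xr' := le_trans (norm_le_enorm x) xr.
  apply: le_trans (ub0 x xr'); rewrite lee_fin.
  have h1 : (M * `|x| <= `|M| * r)%R.
    by apply: le_trans (ler_norm _) _; rewrite normrM normr_id ler_wpM2l.
  by have := ler_norm (- b0)%R; rewrite normrN; lra.
have x0 : (0 < enorm x)%R by apply: le_lt_trans rx.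
have := ur0 x; rewrite (le_lt_trans _ rx) ?le_max ?lexx// => /(_ isT).
rewrite inver gt_eqF// lee_pdivlMr// => h; apply: le_trans h; rewrite -EFinM lee_fin.
have h1 : (M * `|x| <= `|M| * enorm x)%R.
  apply: (@le_trans _ _ (`|M| * `|x|)%R); first by rewrite ler_wpM2r ?ler_norm.
  by rewrite ler_wpM2l ?norm_le_enorm.
have : (0 <= `|M| * r)%R by rewrite mulr_ge0.
by have := normr_ge0 b0; lra.
Qed.

Lemma Conv_sc_noNy u x : Conv_sc u -> u x != -oo.
Proof. by case. Qed.

Lemma Conv_sc_comp u (Q : 'M[R]_n) y : Q \in unitmx -> Conv_sc u ->
  Conv_sc (fun x => u (x *m Q + y)%R).
Proof.
move=> Qu /Conv_scP[ul uc [x0 ux0] ug]; apply/Conv_scP; split.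
- apply/lscP => x a ax.
  have cg : continuous (fun x : 'rV[R]_n => x *m Q + y)%R.
    apply: (@lipschitz_norm_continuous _ _ _ _ (n%:R * `|Q|)%R) => a1 a2.
    rewrite opprD addrACA subrr addr0 -mulmxBl; exact: norm_mulmx.
  by have /lscP/(_ _ _ ax) := ul; exact: cg.
- move=> x1 x2 t t01.
  rewrite (_ : ((t *: x1 + (1 - t) *: x2) *m Q + y =
    t *: (x1 *m Q + y) + (1 - t) *: (x2 *m Q + y))%R); first exact: uc.
  rewrite mulmxDl -!scalemxAl !scalerDr addrACA -scalerDl.
  by rewrite (addrC t) subrK scale1r.
- by exists ((x0 - y) *m invmx Q)%R; rewrite mulmxKV// subrK.
move=> M; pose C := (n%:R * `|invmx Q|)%R.
have C0 : (0 <= C)%R by rewrite mulr_ge0.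
have [b ub] := ug (`|M| * C)%R.
exists (b - `|M| * (C * `|y|))%R => x; apply: le_trans (ub _); rewrite lee_fin.
have h1 : (`|x| <= C * `|x *m Q + y| + C * `|y|)%R.
  rewrite -{1}(mulmxK Qu x) (le_trans (norm_mulmx _ _))// -mulrDr ler_wpM2l//.
  by rewrite -{1}(addrK y (x *m Q)) (le_trans (ler_normB _ _)).
have : (M * `|x| <= `|M| * (C * `|x *m Q + y| + C * `|y|))%R.
  apply: (@le_trans _ _ (`|M| * `|x|)%R); first by rewrite ler_wpM2r ?ler_norm.
  by rewrite ler_wpM2l.
by lra.
Qed.

Definition convex_fun (h : 'rV[R]_n -> R) := forall x y t, (0 <= t <= 1)%R ->
  (h (t *: x + (1 - t) *: y)%R <= t * h x + (1 - t) * h y)%R.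

Lemma lsc_add_continuous u (h : 'rV[R]_n -> R) : (forall x, u x != -oo) ->
  lower_semicontinuous u -> continuous h ->
  lower_semicontinuous (fun x => u x + (h x)%:E).
Proof.
move=> uN /lscP ul hc; apply/lscP => x a ax.
have [r [ru arx]] : exists r, r%:E < u x /\ (a < r + h x)%R.
  move: ax; case: (u x) (uN x) => [s _|_ _|//].
    rewrite -EFinD lte_fin => ash; exists (s - (s + h x - a) / 2)%R.
    by rewrite lte_fin; split; lra.
  by exists (a - h x + 1)%R; rewrite ltry; split=> //; lra.
have /hc : \forall z \near h x, (a - r < z)%R by apply: lt_nbhsr; lra.
move=> hr; near=> y; apply: (@lt_trans _ _ (r + h y)%:E).
  by rewrite lte_fin -ltrBlDl; near: y.
by rewrite EFinD lte_leD//; near: y; exact: ul.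
Unshelve. all: by end_near. Qed.

Lemma Conv_sc_add u (h : 'rV[R]_n -> R) : Conv_sc u ->
  continuous h -> convex_fun h -> (exists C D, forall x, (- (C * `|x|) - D <= h x)%R) ->
  Conv_sc (fun x => u x + (h x)%:E).
Proof.
move=> cu hc hcv [C [D hCD]]; have [uN _ _ _ _] := cu.
have /Conv_scP[ul uc [x0 ux0] ug] := cu; apply/Conv_scP; split.
- exact: lsc_add_continuous.
- move=> x y t t01.
  have {}hcv := hcv x y t t01; have {}uc := uc x y t t01.
  have t0 : (0 <= t)%R by case/andP: t01.
  have t1 : (0 <= 1 - t)%R by case/andP: t01; lra.
  rewrite !muleDr ?fin_num_adde_defl// addeACA -!EFinM -EFinD.
  by rewrite leeD// lee_fin.
- by exists x0; case: (u x0) ux0 (uN x0).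
move=> M; have [b ub] := ug (M + C)%R; exists (b - D)%R => x.
rewrite (_ : M * `|x| + (b - D) = ((M + C) * `|x| + b) + (- (C * `|x|) - D))%R;
  last by ring.
by rewrite EFinD leeD// lee_fin.
Qed.

(** The convex-analytic indicator function. *)
Definition indic (C : set 'rV[R]_n) x : \bar R := if x \in C then 0 else +oo.

Definition convex_set_rV (C : set 'rV[R]_n) := forall x y t, (0 <= t <= 1)%R ->
  C x -> C y -> C (t *: x + (1 - t) *: y)%R.

Definition restrict u C : 'rV[R]_n -> \bar R := fun x => u x + indic C x.

Lemma indic_in C x : C x -> indic C x = 0.
Proof. by move=> Cx; rewrite /indic mem_set. Qed.

Lemma indic_out C x : ~ C x -> indic C x = +oo.
Proof. by move=> Cx; rewrite /indic memNset. Qed.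

Lemma indic_noNy C x : indic C x != -oo.
Proof. by rewrite /indic; case: ifP. Qed.

Lemma indic_ge0 C x : 0 <= indic C x.
Proof. by rewrite /indic; case: ifP. Qed.

Lemma restrict_in u C x : C x -> restrict u C x = u x.
Proof. by move=> Cx; rewrite /restrict indic_in// adde0. Qed.

Lemma restrict_out u C x : u x != -oo -> ~ C x -> restrict u C x = +oo.
Proof. by move=> ux Cx; rewrite /restrict indic_out// addey. Qed.

Lemma restrict_ge u C x : u x <= restrict u C x.
Proof. by rewrite leeDl// indic_ge0. Qed.

Lemma restrict_lsc u C : (forall x, u x != -oo) -> lower_semicontinuous u ->
  closed C -> lower_semicontinuous (restrict u C).
Proof.
move=> uN /lscP ul Cc; apply/lscP => x a; have [Cx|Cx] := pselect (C x).
  rewrite restrict_in// => /ul; apply: filterS => y ay.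
  exact: lt_le_trans (restrict_ge _ _ _).
move=> _; have oC : open (~` C) by exact: closed_openC.
have : \forall y \near x, (~` C) y by exact: open_nbhs_nbhs.
by apply: filterS => y Cy; rewrite restrict_out ?ltry.
Qed.

Lemma restrict_convex u C : (forall x, u x != -oo) -> convex_ereal u ->
  convex_set_rV C -> convex_ereal (restrict u C).
Proof.
move=> uN uc Cc x y t /andP[t0 t1]; have t1' : (0 <= 1 - t)%R by lra.
have [->|tN0] := eqVneq t 0%R.
  by rewrite scale0r add0r subr0 scale1r mul0e mul1e add0e.
have [->|tN1] := eqVneq t 1%R.
  by rewrite subrr scale0r addr0 scale1r mul0e mul1e adde0.
have tp : (0 < t)%R by rewrite lt_neqAle eq_sym tN0.
have tp' : (0 < 1 - t)%R by rewrite subr_gt0 lt_neqAle tN1.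
have rN z : restrict u C z != -oo.
  have [Cz|Cz] := pselect (C z); first by rewrite restrict_in.
  by rewrite restrict_out.
have sN (s : R) z : (0 < s)%R -> s%:E * restrict u C z != -oo.
  move=> s0; case: (restrict u C z) (rN z) => [r|_|//] //.
  by rewrite gt0_muley ?lte_fin.
have [Cx|Cx] := pselect (C x); last first.
  by rewrite (restrict_out (uN x) Cx) gt0_muley ?lte_fin// addye ?sN// leey.
have [Cy|Cy] := pselect (C y); last first.
  by rewrite (restrict_out (uN y) Cy) gt0_muley ?lte_fin// addey ?sN// leey.
rewrite !restrict_in//; first by apply: uc; rewrite t0.
by apply: Cc => //; rewrite t0.
Qed.

Lemma Conv_sc_restrict u C x0 : Conv_sc u -> closed C -> convex_set_rV C ->
  C x0 -> u x0 != +oo -> Conv_sc (restrict u C).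
Proof.
move=> cu Cc Ccv Cx0 ux0; have [uN _ _ _ _] := cu.
have /Conv_scP[ul uc _ ug] := cu; apply/Conv_scP; split.
- exact: restrict_lsc.
- exact: restrict_convex.
- by exists x0; rewrite restrict_in.
by move=> M; have [b ub] := ug M; exists b => x; apply: le_trans (restrict_ge _ _ _).
Qed.

Lemma restrict_cst0 C : restrict (fun=> 0) C = indic C.
Proof. by apply/funext => x; rewrite /restrict add0e. Qed.

Lemma Conv_sc_indic C x0 r : closed C -> convex_set_rV C -> C x0 ->
  (forall x, C x -> (`|x| <= r)%R) -> Conv_sc (indic C).
Proof.
move=> Cc Ccv Cx0 Cr; apply/Conv_scP; split.
- rewrite -restrict_cst0; apply: restrict_lsc => //.
  by apply/lscP => x a a0; near=> y.
- rewrite -restrict_cst0; apply: restrict_convex => // x y t _.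
  by rewrite !mule0 adde0.
- by exists x0; rewrite indic_in.
move=> M; exists (- (`|M| * r))%R => x; have [Cx|Cx] := pselect (C x).
  rewrite indic_in// lee_fin subr_le0 (le_trans (ler_norm _))// normrM normr_id.
  by rewrite ler_wpM2l// Cr.
by rewrite indic_out// leey.
Unshelve. all: by end_near. Qed.

(** The bound [|x| + b <= u x] confines the search for a minimum to a ball. *)
Lemma Conv_sc_min u : Conv_sc u -> exists x, forall y, u x <= u y.
Proof.
move=> cu; have [uN _ _ _ _] := cu; have /Conv_scP[ul uc [x0 ux0] ug] := cu.
have [r ur] : exists r, u x0 = r%:E by case: (u x0) ux0 (uN x0) => // r; exists r.
have [b ub] := ug 1%R.
have [|x xK xmin] := lsc_min (@ball_compact R n `|r - b|%R) ul _ uN.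
  exists x0 => //=; have := ub x0; rewrite ur lee_fin mul1r.
  by have := ler_norm (r - b)%R; lra.
exists x => y; have [yK|yK] := leP `|y|%R `|r - b|%R; first exact: xmin.
have x0K : (`|x0| <= `|r - b|)%R.
  have := ub x0; rewrite ur lee_fin mul1r.
  by have := ler_norm (r - b)%R; lra.
apply: le_trans (xmin _ x0K) _; rewrite ur; apply: le_trans (ub y).
by rewrite lee_fin mul1r; have := ler_norm (r - b)%R; lra.
Qed.

Lemma Conv_sc_fin_min u : Conv_sc u ->
  exists x (m : R), u x = m%:E /\ forall y, m%:E <= u y.
Proof.
move=> cu; have [x xmin] := Conv_sc_min cu; have [uN _ _ [x0 ux0] _] := cu.
have := xmin x0; case uE : (u x) (uN x) => [m| |//] _ um.
  by exists x, m; rewrite -uE.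
by move: um; rewrite leye_eq => /eqP ux; move: ux0; rewrite ux.
Qed.

End conv_sc.

(** * Epi-convergence and the minimum *)

Section ereal_limits.
Local Open Scope ereal_scope.
Context {R : realType}.
Implicit Types (v : nat -> \bar R) (L : \bar R).

Lemma limn_einf_gt v (r : R) : r%:E < limn_einf v -> \forall i \near \oo, r%:E < v i.
Proof.
have /cvg_lim E := @cvg_einfs_sup R v.
rewrite limn_einf_lim E// => /ereal_sup_gt[_ [N _ <-]] rN.
exists N => // i /= Ni; apply: lt_le_trans rN _.
by apply: ereal_inf_lbound; exists i.
Qed.

Lemma ereal_le_dense (L L' : \bar R) : (forall r : R, r%:E < L -> r%:E <= L') -> L <= L'.
Proof.
move=> LL'; case: L LL' => [t| |] LL'; last by rewrite leNye.
  case: L' LL' => [s| |] LL'; first last.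
  - by have := LL' (t - 1)%R; rewrite lte_fin leeNy_eq ltrBlDr ltrDl ltr01 => /(_ isT).
  - by rewrite leey.
  rewrite lee_fin leNgt; apply/negP => st.
  have : ((s + t) / 2 < t)%R by lra.
  by rewrite -lte_fin => /LL'; rewrite lee_fin; lra.
case: L' LL' => [s| |] LL'; [|by []|].
  by have := LL' (s + 1)%R (ltry _); rewrite lee_fin => h; exfalso; lra.
by have := LL' 0%R (ltry _); rewrite leeNy_eq.
Qed.

Lemma limn_einf_ge v L :
  (forall r : R, r%:E < L -> \forall i \near \oo, r%:E <= v i) -> L <= limn_einf v.
Proof.
move=> Lv; apply: ereal_le_dense => r /Lv[N _ Nv].
have /cvg_lim E := @cvg_einfs_sup R v.
rewrite limn_einf_lim E//.
apply: (@le_trans _ _ (einfs v N)); last by apply: ereal_sup_ubound; exists N.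
by apply: le_ereal_inf_tmp => _ [i /= Ni <-]; exact: Nv.
Qed.

Lemma ereal_cvg_order v L :
  (forall r : R, r%:E < L -> \forall i \near \oo, r%:E < v i) ->
  (forall r : R, L < r%:E -> \forall i \near \oo, v i < r%:E) ->
  v @ \oo --> L.
Proof.
move=> lo up; case: L lo up => [s||] lo up A /=; rewrite /nbhs/=.
- move=> /nbhs_ballP[e /= e0 sA].
  have {}lo := lo (s - e)%R; have {}up := up (s + e)%R.
  rewrite lte_fin in lo; rewrite lte_fin in up.
  near=> i; have : (s - e)%:E < v i by near: i; apply: lo; lra.
  have : v i < (s + e)%:E by near: i; apply: up; lra.
  case viE : (v i) => [t| |]//; rewrite !lte_fin => tu tl; rewrite /= viE.
  by apply: sA; rewrite /ball/= ltr_distlC; apply/andP; split; lra.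
- by move=> [M [Mr MA]]; have := lo M (ltry _); apply: filterS => i; exact: MA.
- by move=> [M [Mr MA]]; have := up M (ltNyr _); apply: filterS => i; exact: MA.
Unshelve. all: by end_near. Qed.


End ereal_limits.

Section epi.
Local Open Scope ereal_scope.
Context {R : realType} {n : nat}.
Implicit Types (u v : 'rV[R]_n -> \bar R) (us : nat -> 'rV[R]_n -> \bar R).
Implicit Types (x y z p : 'rV[R]_n).

(** Every epi-limit met here is a pointwise limit, so constant recovery
    sequences do; the minorants [w] supply the inequality on lower limits. *)
Lemma epi_cvg_of_minorants us u (w : nat -> 'rV[R]_n -> \bar R) :
  (forall m, lower_semicontinuous (w m)) ->
  (forall m k x, (m <= k)%N -> w m x <= us k x) ->
  (forall x (r : R), r%:E < u x -> exists m, r%:E < w m x) ->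
  (forall x (r : R), u x < r%:E -> \forall k \near \oo, us k x < r%:E) ->
  epi_cvg us u.
Proof.
move=> wl wu uw up x.
have lo y (y_ : nat -> 'rV[R]_n) (r : R) : y_ @ \oo --> y -> r%:E < u y ->
    \forall k \near \oo, r%:E < us k (y_ k).
  move=> yy /uw[m rm].
  have /yy [N _ Nw] : \forall z \near y, r%:E < w m z by exact: (lscP _).1.
  exists (maxn N m) => // k /=; rewrite geq_max => /andP[Nk mk].
  by apply: lt_le_trans (wu m k _ mk); exact: Nw.
split=> [x_ xx|].
  by apply: limn_einf_ge => r ru; apply: filterS (lo _ _ _ xx ru) => k; exact: ltW.
exists (fun=> x); first exact: cvg_cst.
by apply: ereal_cvg_order => [r|r]; [apply: lo; exact: cvg_cst | exact: up].
Qed.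

Lemma epi_cvg_below us u :
  (forall m, lower_semicontinuous (us m)) ->
  (forall m k x, (m <= k)%N -> us m x <= us k x) ->
  (forall k x, us k x <= u x) ->
  (forall x (r : R), r%:E < u x -> exists m, r%:E < us m x) ->
  epi_cvg us u.
Proof.
move=> ul um ub uu; apply: (epi_cvg_of_minorants (w := us)) => // x r ur.
by near=> k; apply: le_lt_trans ur.
Unshelve. all: by end_near. Qed.

(** The condition on lower limits along sequences is uniform near [p]. Otherwise there
    would be points approaching [p] along arbitrarily large indices at which
    [us] stays below [r]; completed by [p] itself at the other indices they
    would form a sequence converging to [p]. *)
Lemma epi_liminf us u p (r : R) : epi_cvg us u -> r%:E < u p ->
  exists A N, nbhs p A /\ forall y k, A y -> (N <= k)%N -> r%:E < us k y.
Proof.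
move=> /(_ p)[liminf _] rp; apply: contrapT => bad.
have H k : exists yi : 'rV[R]_n * nat,
    [/\ (`|p - yi.1| < k.+1%:R^-1)%R, (k <= yi.2)%N & ~ (r%:E < us yi.2 yi.1)].
  apply: contrapT => nbad; apply: bad.
  exists (ball p k.+1%:R^-1), k; split.
    by apply: nbhsx_ballx; rewrite invr_gt0.
  rewrite -ball_normE => y i /= py ki.
  by apply: contrapT => nr; apply: nbad; exists (y, i).
have [f fP] := choice H.
pose x_ i := if pselect (exists k, (f k).2 = i) is left h then (f (projT1 (cid h))).1
  else p.
have x_p : x_ @ \oo --> p.
  apply/cvgrPdist_lt => /= e e0.
  have [K Ke] := nat_gt (e^-1)%R.
  have [N NP] : exists N, forall k, (k < K)%N -> ((f k).2 < N)%N.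
    exists (\max_(k < K) (f k).2).+1 => k kK.
    by rewrite ltnS (leq_bigmax (Ordinal kK)).
  exists N => // i /= Ni; rewrite /x_; case: pselect => [h|_]; last first.
    by rewrite subrr normr0.
  case: cid => k /= ki; have [pk _ _] := fP k; apply: lt_le_trans pk _.
  have Kk : (K <= k)%N.
    by rewrite leqNgt; apply/negP => /NP; rewrite ki ltnNge Ni.
  rewrite invf_ple ?posrE ?ltr0Sn//; apply: le_trans (ltW Ke) _.
  by rewrite ler_nat (leq_trans Kk).
have /limn_einf_gt [N _ Nu] := lt_le_trans rp (liminf _ x_p).
have [_ NfN _] := fP N.
have := Nu (f N).2 NfN; rewrite /x_ /=; case: pselect => [h|]; last first.
  by case; exists N.
by case: cid => k /= kf; have [_ _] := fP k; rewrite kf.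
Qed.

Lemma epi_recovery us u p (r : R) : epi_cvg us u -> u p < r%:E ->
  exists x_ : nat -> 'rV[R]_n, x_ @ \oo --> p /\
    \forall k \near \oo, us k (x_ k) < r%:E.
Proof.
move=> /(_ p)[_ [x_ xp xu]] ur; exists x_; split=> //.
have H : nbhs (u p) [set z | z < r%:E].
  by apply: open_nbhs_nbhs; split=> //; exact: open_ereal_lt_ereal.
exact: (xu _ H).
Qed.

Lemma epi_cvg_add us u (h : 'rV[R]_n -> R) : (forall i x, us i x != -oo) ->
  (forall x, u x != -oo) -> continuous h -> epi_cvg us u ->
  epi_cvg (fun i x => us i x + (h x)%:E) (fun x => u x + (h x)%:E).
Proof.
move=> uiN uN hc uu p; split=> [x_ xp|].
  apply: limn_einf_ge => r ru.
  have [s [su rs]] : exists s, s%:E < u p /\ (r < s + h p)%R.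
    move: ru; case: (u p) (uN p) => [t _|_ _|//].
      rewrite -EFinD lte_fin => ash; exists (t - (t + h p - r) / 2)%R.
      by rewrite lte_fin; split; lra.
    by exists (r - h p + 1)%R; rewrite ltry; split=> //; lra.
  have [A [N [pA AN]]] := epi_liminf uu su.
  have hx : h \o x_ @ \oo --> h p by apply: cvg_comp xp _; exact: hc.
  near=> k; have hk : (r - s < h (x_ k))%R.
    by near: k; apply: (hx [set z | (r - s < z)%R]); apply: lt_nbhsr; lra.
  apply: (@le_trans _ _ (s + h (x_ k))%:E); first by rewrite lee_fin; lra.
  rewrite EFinD leeD2r// ltW//; apply: AN; last by near: k; exists N.
  by near: k; exact: xp.
have [_ [x_ xp xu]] := uu p; exists x_ => //.
have hx : (fun i => (h (x_ i))%:E) @ \oo --> (h p)%:E.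
  apply: (cvg_comp _ _ (_ : h \o x_ @ \oo --> h p)) => //.
  by apply: cvg_comp xp _; exact: hc.
by apply: cvgeD => //; rewrite fin_num_adde_defl.
Unshelve. all: by end_near. Qed.

(** Minus the value of the Legendre transform at the origin. *)
Definition minval u : R := fine (ereal_inf (range u)).

Lemma minvalP u : Conv_sc u -> ereal_inf (range u) = (minval u)%:E /\
  (exists x, u x = (minval u)%:E) /\ forall y, (minval u)%:E <= u y.
Proof.
move=> /Conv_sc_fin_min[x [m [ux um]]].
have E : ereal_inf (range u) = m%:E.
  apply/eqP; rewrite eq_le; apply/andP; split.
    by rewrite -ux; apply: ereal_inf_lbound; exists x.
  by apply: le_ereal_inf_tmp => _ [y _ <-].
by rewrite /minval E /=; split=> //; split=> //; exists x.
Qed.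

Lemma minval_eq u x (m : R) : u x = m%:E -> (forall y, m%:E <= u y) -> minval u = m.
Proof.
move=> ux um; rewrite /minval (_ : ereal_inf _ = m%:E)//.
apply/eqP; rewrite eq_le; apply/andP; split.
  by rewrite -ux; apply: ereal_inf_lbound; exists x.
by apply: le_ereal_inf_tmp => _ [y _ <-].
Qed.

Lemma convex_ereal_le u x y t (M : R) : convex_ereal u -> (0 <= t <= 1)%R ->
  u x <= M%:E -> u y <= M%:E -> u (t *: x + (1 - t) *: y)%R <= M%:E.
Proof.
move=> uc t01 ux uy; apply: le_trans (uc x y t t01) _.
have [t0 t1] : (0 <= t /\ 0 <= 1 - t)%R by case/andP: t01 => ? ?; split=> //; lra.
rewrite (_ : M%:E = t%:E * M%:E + (1 - t)%:E * M%:E); last first.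
  by rewrite -!EFinM -EFinD; congr EFin; ring.
by rewrite leeD// lee_wpmul2l// lee_fin.
Qed.

Lemma segment_norm x y (r : R) : (`|x| <= r)%R -> (r <= `|y|)%R ->
  exists2 t, (0 <= t <= 1)%R & `|t *: x + (1 - t) *: y|%R = r.
Proof.
move=> xr ry; pose g (t : R) := `|t *: x + (1 - t) *: y|%R.
have gc : continuous g.
  move=> t; apply: continuous_comp; last exact: norm_continuous.
  apply: (@continuousD _ _ _ (fun t : R => t *: x)%R (fun t : R => (1 - t) *: y)%R).
    exact: scalel_continuous.
  apply: (@continuous_comp _ _ _ (fun t : R => 1 - t)%R (fun s : R => s *: y)%R).
    by apply: cvgB; [exact: cvg_cst | exact: cvg_id].
  exact: scalel_continuous.
have [||t] := @IVT R g 0%R 1%R r ler01.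
- exact: continuous_subspaceT.
- rewrite /g scale0r add0r subr0 scale1r subrr scale0r addr0 scale1r.
  by rewrite ge_min le_max xr ry orbT.
by rewrite in_itv /= => t01 gt; exists t.
Qed.

(** On a large sphere the limit exceeds its minimum by more than one, hence so
    does [us i] for large [i] by compactness. By convexity along segments
    starting at a recovery sequence, [us i] is also large outside the sphere, so only a
    compact ball matters. *)
Lemma minval_cvg us u : (forall i, Conv_sc (us i)) -> Conv_sc u ->
  epi_cvg us u -> (fun i => minval (us i)) @ \oo --> minval u.
Proof.
move=> cu_ cu uu; have [_ [[y0 uy0] um]] := minvalP cu.
set m := minval u in uy0 um *.
apply/cvgrPdist_lt => /= e' e'0; pose e := Num.min e' 1%R.
have e0 : (0 < e)%R by rewrite lt_min e'0 ltr01.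
have ee' : (e <= e')%R by rewrite ge_min lexx.
have e1 : (e <= 1)%R by rewrite ge_min lexx orbT.
have /Conv_scP[_ _ _ ug] := cu; have [b ub] := ug 1%R.
(* the radius beyond which [|y| + b], hence [u], exceeds [m + 1], enlarged so
   that the ball contains [y0] in its interior *)
pose rho := (`|m + 2 - b| + `|y0| + 1)%R.
have rhoS y : (rho <= `|y|)%R -> (m + 1)%:E < u y.
  move=> ry; apply: lt_le_trans (ub y); rewrite lte_fin mul1r.
  by have := ler_norm (m + 2 - b); have := normr_ge0 y0; rewrite /rho in ry; lra.
have [//|y Ky|N1 N1P] := @compact_eventually R n [set y | `|y| <= rho]%R
  (fun k y => (m - e)%:E < us k y); first exact: ball_compact.
  by apply: (epi_liminf uu); apply: lt_le_trans (um y); rewrite lte_fin; lra.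
have [//|y [_ Ky]|N2 N2P] := @compact_eventually R n
  ([set y | `|y| <= rho]%R `&` [set y | rho <= `|y|]%R)
  (fun k y => (m + 1)%:E < us k y).
- apply: compact_closedI; first exact: ball_compact.
  have -> : [set y : 'rV[R]_n | rho <= `|y|]%R = Num.norm @^-1` [set s | rho <= s]%R by [].
  by apply: closed_comp; [move=> y _; exact: norm_continuous | exact: closed_ge].
- by apply: (epi_liminf uu); exact: rhoS.
have [|z_ [zy0 zu]] := @epi_recovery us u y0 (m + e)%R uu.
  by rewrite uy0 lte_fin; lra.
have zrho : \forall i \near \oo, (`|z_ i| < rho)%R.
  have zn : (fun i => `|z_ i|%R) @ \oo --> `|y0|%R by exact: cvg_norm.
  apply: (zn [set s | s < rho]%R); apply: lt_nbhsl.
  by rewrite /rho; have := normr_ge0 (m + 2 - b)%R; lra.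
near=> i.
have [_ [[w uw] ui]] := minvalP (cu_ i).
have zi : us i (z_ i) < (m + e)%:E by near: i.
have zr : (`|z_ i| < rho)%R by near: i.
have up : (minval (us i) < m + e)%R by rewrite -lte_fin; apply: le_lt_trans (ui _) zi.
have lo : (m - e < minval (us i))%R.
  rewrite -lte_fin -uw; have [wr|wr] := leP `|w|%R rho.
    by apply: N1P => //; near: i; exists N1.
  have [t t01 tr] := segment_norm (ltW zr) (ltW wr).
  rewrite ltNge; apply/negP => wm.
  have : us i (t *: z_ i + (1 - t) *: w)%R <= (m + 1)%:E.
    have /Conv_scP[_ uic _ _] := cu_ i; apply: convex_ereal_le => //.
      by apply/ltW/(lt_le_trans zi); rewrite lee_fin; lra.
    by apply: le_trans wm _; rewrite lee_fin; lra.
  apply/negP; rewrite -ltNge; apply: N2P; first by near: i; exists N2.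
  by rewrite /= tr.
by rewrite ltr_distlC; apply/andP; split; lra.
Unshelve. all: by end_near. Qed.

Lemma closed_sublevel_segment u x y (M : R) : lower_semicontinuous u ->
  closed [set t : R | u (t *: x + (1 - t) *: y)%R <= M%:E].
Proof.
move=> ul; pose g (t : R) := (t *: x + (1 - t) *: y)%R.
have gc : continuous g.
  move=> t.
  apply: (@continuousD _ _ _ (fun t : R => t *: x)%R (fun t : R => (1 - t) *: y)%R).
    exact: scalel_continuous.
  apply: (@continuous_comp _ _ _ (fun t : R => 1 - t)%R (fun s : R => s *: y)%R).
    by apply: cvgB; [exact: cvg_cst | exact: cvg_id].
  exact: scalel_continuous.
rewrite (_ : mkset _ = ~` (g @^-1` [set z | M%:E < u z])); last first.
  by apply/seteqP; split=> t /=; rewrite leNgt => /negP.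
apply: open_closedC; apply: open_comp; first by move=> t _; exact: gc.
exact: (lower_semicontinuousP _).1.
Qed.

(** Let [x] and [y] be minimizers of [u] and [v], and [M] the larger minimum. On
    the segment from [x] to [y] the convex function [u \min v] is at most [M],
    so the closed sets where [u] and where [v] is at most [M] cover it; as the
    segment is connected they meet, and there [u \max v] is at most [M]. *)
Lemma minval_valuation u v : Conv_sc u -> Conv_sc v ->
  Conv_sc (u \max v) -> Conv_sc (u \min v) ->
  (minval (u \max v) + minval (u \min v) = minval u + minval v)%R.
Proof.
move=> cu cv cM cm.
have [_ [[x ux] um]] := minvalP cu; have [_ [[y vy] vm]] := minvalP cv.
set a := minval u in ux um *; set b := minval v in vy vm *.
have -> : minval (u \min v) = Num.min a b.
  have [ab|ba] := leP a b.
    apply: (@minval_eq _ x) => [|z] /=.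
      rewrite ux min_l//; apply: le_trans (vm x); by rewrite lee_fin.
    by rewrite le_min um/=; apply: le_trans (vm z); rewrite lee_fin.
  apply: (@minval_eq _ y) => [|z] /=.
    by rewrite vy min_r//; apply: le_trans (um y); rewrite lee_fin ltW.
  by rewrite le_min vm andbT; apply: le_trans (um z); rewrite lee_fin ltW.
suff -> : minval (u \max v) = Num.max a b by rewrite addr_max_min.
set M := Num.max a b.
have aM : (a <= M)%R by rewrite le_max lexx.
have bM : (b <= M)%R by rewrite le_max lexx orbT.
have Mle z : M%:E <= (u \max v) z.
  rewrite /= le_max /M; have [ab|ba] := leP a b; first by rewrite vm orbT.
  by rewrite um.
suff [z [uz vz]] : exists z, u z <= M%:E /\ v z <= M%:E.
  apply: (@minval_eq _ z) => //; apply/eqP; rewrite eq_le Mle andbT.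
  by rewrite ge_max uz vz.
pose g (t : R) := (t *: x + (1 - t) *: y)%R.
pose A := [set t : R | u (g t) <= M%:E]; pose B := [set t : R | v (g t) <= M%:E].
have Ac : closed A by apply: closed_sublevel_segment; case: cu.
have Bc : closed B by apply: closed_sublevel_segment; case: cv.
have g1 : g 1%R = x by rewrite /g subrr scale0r scale1r addr0.
have g0 : g 0%R = y by rewrite /g subr0 scale0r scale1r add0r.
have A1 : A 1%R by rewrite /A /= g1 ux lee_fin.
have B0 : B 0%R by rewrite /B /= g0 vy lee_fin.
have AB (t : R) : `[0%R, 1%R]%classic t -> A t \/ B t.
  rewrite /= in_itv /= => t01.
  have /Conv_scP[_ mc _ _] := cm.
  have : (u \min v) (g t) <= M%:E.
    apply: convex_ereal_le => //.
      by rewrite /= ge_min ux lee_fin aM.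
    by rewrite /= ge_min vy lee_fin bM orbT.
  by rewrite /= ge_min => /orP[]; [left|right].
apply: contrapT => nz.
have nAB t : A t -> B t -> False by move=> At Bt; apply: nz; exists (g t).
have E : `[0%R, 1%R]%classic `&` A = `[0%R, 1%R]%classic.
  apply: (@segment_connected R 0%R 1%R).
  - by exists 1%R; split=> //=; rewrite in_itv /= ler01 lexx.
  - exists (~` B); first exact: closed_openC.
    apply/seteqP; split=> t /= [t01 h]; split=> //; first exact: nAB.
    by case: (AB t).
  - by exists A.
have : (`[0%R, 1%R]%classic `&` A) 0%R by rewrite E /= in_itv /= lexx ler01.
by case=> _ A0; exact: nAB A0 B0.
Qed.

End epi.

(** * The Legendre transform and the sufficiency part *)

Section legendre_transform.
Local Open Scope ereal_scope.
Context {R : realType} {n : nat}.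
Implicit Types (u v : 'rV[R]_n -> \bar R) (x y z w : 'rV[R]_n).

Definition addlin u y : 'rV[R]_n -> \bar R := fun z => u z + (ell y z)%:E.

Lemma ell_continuous y : continuous (@ell R n y).
Proof. exact: dot_continuous. Qed.

Lemma ell_convex y : convex_fun (@ell R n y).
Proof. by move=> a b t _; rewrite /ell dotDl !dotZl. Qed.

Lemma ell_bound y : exists C D, forall x, (- (C * `|x|) - D <= ell y x)%R.
Proof.
exists (n%:R * `|y|)%R, 0%R => x; rewrite subr0 lerNl.
by apply: le_trans (ler_norm _) _; rewrite normrN dot_le_norm.
Qed.

Lemma Conv_sc_addlin u y : Conv_sc u -> Conv_sc (addlin u y).
Proof.
move=> cu; apply: Conv_sc_add => //; [exact: ell_continuous|exact: ell_convex|].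
exact: ell_bound.
Qed.

Lemma Conv_sc_addc u (c : R) : Conv_sc u -> Conv_sc (fun x => u x + c%:E).
Proof.
move=> cu; apply: (Conv_sc_add (h := fun=> c)) => //.
- exact: cst_continuous.
- by move=> x y t _; rewrite -mulrDl (_ : t + (1 - t) = 1)%R ?mul1r//; ring.
- by exists 0%R, `|c|%R => x; rewrite mul0r oppr0 add0r lerNl -normrN ler_norm.
Qed.

Lemma Conv_sc_translate u y : Conv_sc u -> Conv_sc (translate y u).
Proof.
move=> /(@Conv_sc_comp _ _ _ 1%:M (- y)%R (unitmx1 _ _)).
by under eq_fun do rewrite mulmx1.
Qed.

Lemma minval_addc u (c : R) : Conv_sc u ->
  minval (fun x => u x + c%:E) = (minval u + c)%R.
Proof.
move=> /minvalP[_ [[x ux] um]].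
apply: (@minval_eq _ _ _ x) => [|y]; first by rewrite ux.
by rewrite EFinD leeD2r.
Qed.

Lemma minval_comp u (g : 'rV[R]_n -> 'rV[R]_n) : (forall y, exists x, g x = y) ->
  minval (u \o g) = minval u.
Proof.
move=> gs; rewrite /minval (_ : range (u \o g) = range u)//.
apply/seteqP; split=> _ [x _ <-]; first by exists (g x).
by have [z <-] := gs x; exists z.
Qed.

Lemma legendreE u x : Conv_sc u -> legendre u x = (- minval (addlin u (- x)))%:E.
Proof.
move=> cu; have [E _] := minvalP (Conv_sc_addlin (- x) cu).
rewrite /legendre EFinN -E /ereal_inf oppeK; congr ereal_sup.
have [uN _ _ _ _] := cu.
apply/seteqP; split=> [_ [y _ <-]|_ [_ [y _ <-] <-]].
  exists (addlin u (- x) y); first by exists y.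
  rewrite /addlin /ell dotNr EFinN oppeD ?fin_num_adde_defl// oppeK.
  by rewrite addeC dotC.
exists y => //; rewrite /addlin /ell dotNr EFinN oppeD ?fin_num_adde_defl// oppeK.
by rewrite addeC dotC.
Qed.

Lemma dot_mulmx x y (Q : 'M[R]_n) : dot (x *m Q) y = dot x (y *m Q^T).
Proof.
rewrite /dot; under eq_bigr do rewrite mxE mulr_suml.
rewrite exchange_big /=; apply: eq_bigr => i _; rewrite mxE mulr_sumr.
by apply: eq_bigr => j _; rewrite mxE; ring.
Qed.

Lemma addlin_max u v y : addlin (u \max v) y = addlin u y \max addlin v y.
Proof. by apply/funext => x; rewrite /addlin /= adde_maxl. Qed.

Lemma addlin_min u v y : addlin (u \min v) y = addlin u y \min addlin v y.
Proof.
apply/funext => x; rewrite /addlin /=; have [uv|vu] := leP (u x) (v x).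
  by rewrite min_l// leeD2r.
by rewrite min_r// leeD2r// ltW.
Qed.

End legendre_transform.

Section sufficiency.
Local Open Scope ereal_scope.
Context {R : realType} {n : nat}.
Context {Z : transform R n} {eps sigma c c' : R}.
Context (Zrep : representation Z eps sigma c c').
Implicit Types (u v : 'rV[R]_n -> \bar R) (x y z w : 'rV[R]_n).

Let Zneq u x : eps != 0%R -> Conv_sc u ->
  Z u x = (- (eps * sigma) * minval (addlin u (- (eps^-1 *: x))) + c)%R.
Proof.
move=> e0 cu; apply/EFin_inj; rewrite Zrep// e0 legendreE// -EFinM -EFinD.
by congr EFin; rewrite mulrN mulNr.
Qed.

Let Zeq u x : eps = 0%R -> Conv_sc u -> Z u x = (c' * delta0 x + c)%R.
Proof. by move=> e0 cu; apply/EFin_inj; rewrite Zrep// e0 eqxx. Qed.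

Lemma representation_epi_continuous : epi_continuous Z.
Proof.
move=> us u cus cu usu x; have [e0|e0] := eqVneq eps 0%R.
  under eq_fun do rewrite Zeq//.
  by rewrite Zeq//; exact: cvg_cst.
under eq_fun do rewrite Zneq//.
rewrite Zneq//; apply: cvgD; last exact: cvg_cst.
apply: cvgM; first exact: cvg_cst.
apply: minval_cvg => [i||]; [exact: Conv_sc_addlin|exact: Conv_sc_addlin|].
apply: epi_cvg_add => //; last exact: ell_continuous.
  by move=> i z; exact: Conv_sc_noNy.
by move=> z; exact: Conv_sc_noNy.
Qed.

Lemma representation_valuation : valuation Z.
Proof.
move=> u v cu cv cM cm x; have [e0|e0] := eqVneq eps 0%R; first by rewrite !Zeq.
rewrite !Zneq//; set w := (- (eps^-1 *: x))%R.
have := minval_valuation (Conv_sc_addlin w cu) (Conv_sc_addlin w cv).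
rewrite -addlin_max -addlin_min.
move=> /(_ (Conv_sc_addlin w cM) (Conv_sc_addlin w cm)) H.
by rewrite addrACA -mulrDr H; ring.
Qed.

Lemma representation_SL_contravariant : SL_contravariant Z.
Proof.
move=> u cu phi dphi x.
have phiu : phi \in unitmx by rewrite unitmxE dphi unitr1.
have cuphi : Conv_sc (u \o mxact (invmx phi)).
  have := @Conv_sc_comp _ _ u (invmx phi)^T 0%R _ cu.
  rewrite unitmx_tr unitmx_inv => /(_ phiu).
  by under eq_fun do rewrite addr0.
have [e0|e0] := eqVneq eps 0%R.
  rewrite !Zeq//; congr (_ * _ + _)%R; rewrite /delta0 /mxact trmxK.
  congr (_%:R)%R; congr nat_of_bool; apply/eqP/eqP => [->|xphi]; first by rewrite mul0mx.
  by rewrite -(mulmxK phiu x) xphi mul0mx.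
rewrite !Zneq//; congr (_ * _ + _)%R.
rewrite -(@minval_comp _ _ (addlin u _) (mxact (invmx phi))); last first.
  move=> y; exists (y *m phi^T); rewrite /mxact.
  by rewrite -mulmxA -trmx_mul mulVmx// trmx1 mulmx1.
congr minval; apply/funext => y; rewrite /addlin /= /ell /mxact trmxK.
rewrite dot_mulmx trmxK mulNmx -scalemxAl mulmxK//.
Qed.

Lemma representation_translation : exists A' : 'rV[R]_n -> 'rV[R]_n,
  (eps <> 0%R -> A' = (fun y => sigma *: y)) /\ translation_equations Z eps A'.
Proof.
have [e0|e0] := eqVneq eps 0%R.
  exists (fun=> 0%R); split=> // u cu y x.
  rewrite Zeq//; last exact: Conv_sc_translate.
  rewrite Zeq// /ell dot0r addr0; split=> //.
  rewrite Zeq//; last exact: Conv_sc_addlin.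
  by rewrite /translate Zeq// e0 scale0r subr0.
exists (fun y => sigma *: y); split=> // u cu y x; split.
  rewrite Zneq//; last exact: Conv_sc_translate.
  rewrite Zneq//; set w := (eps^-1 *: x)%R.
  have -> : addlin (translate y u) (- w) =
      (fun z => addlin u (- w) z + (- dot y w)%:E) \o (fun z => z - y)%R.
    apply/funext => z /=; rewrite /addlin /translate /ell -addeA -EFinD.
    by congr (_ + _%:E); rewrite dotDl !dotNr dotNl; ring.
  rewrite minval_comp; last by move=> z; exists (z + y)%R; rewrite addrK.
  rewrite minval_addc; last exact: Conv_sc_addlin.
  by rewrite /w /ell !dotZr (dotC x); field.
rewrite (_ : (fun z => _) = addlin u y)// /translate Zneq//; last exact: Conv_sc_addlin.
rewrite Zneq//; congr (_ * minval _ + _)%R; apply/funext => z.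
rewrite /addlin -addeA -EFinD; congr (_ + _%:E).
by rewrite scalerDr scalerN scalerA mulVf// scale1r /ell opprB dotDr; ring.
Qed.

End sufficiency.

(** * Maps commuting with the special linear group *)

Section special_linear.
Context {R : realType} {n : nat}.

Lemma mulmx_diag_entry (y d : 'rV[R]_n) j :
  (y *m diag_mx d) ord0 j = y ord0 j * d ord0 j.
Proof.
rewrite mxE (bigD1 j) //= mxE eqxx mulr1n big1 ?addr0// => i ij.
by rewrite mxE (negPf ij) mulr0n mulr0.
Qed.

Definition stretch (j : 'I_n) (a : R) : 'rV[R]_n := \row_i (if i == j then a else 1).

Lemma det_stretch j a : \det (diag_mx (stretch j a)) = a.
Proof.
rewrite det_diag (bigD1 j) //= mxE eqxx big1 ?mulr1// => i ij.
by rewrite mxE (negPf ij).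
Qed.

(** Complete [y] to an invertible matrix having it as row [i], then rescale row
    [j] to correct the determinant. *)
Lemma SL_transitive (i j : 'I_n) (y : 'rV[R]_n) : i != j -> y != 0 ->
  exists2 Q : 'M[R]_n, \det Q = 1 & delta_mx ord0 i *m Q = y.
Proof.
move=> ij y0; pose e : 'rV[R]_n := delta_mx ord0 i.
have ey : e *m (\matrix_k y) = y by rewrite -rowE rowK.
have e0 : e != 0.
  apply/eqP => /rowP/(_ i); rewrite !mxE !eqxx => /eqP.
  by rewrite oner_eq0.
have [|g gu eg] := @complete_unitmx _ _ _ e (\matrix_k y).
  by rewrite ey !rank_rV y0 e0.
exists (diag_mx (stretch j (\det g)^-1) *m g).
  by rewrite det_mulmx det_stretch mulVr// -unitmxE.
rewrite mulmxA -[RHS]ey eg; congr (_ *m _); apply/rowP => k.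
rewrite mulmx_diag_entry !mxE; case: (k =P j) => [->|_]; last by rewrite mulr1.
by rewrite eq_sym (negPf ij) andbF mul0r.
Qed.

Lemma ord_avoid2 (a b : 'I_n) : (3 <= n)%N -> exists k : 'I_n, k != a /\ k != b.
Proof.
move=> n3; apply: contrapT => no.
have sub : {subset enum 'I_n <= [:: a; b]}.
  move=> k _; rewrite !inE; apply/negPn/negP; rewrite negb_or => /andP[ka kb].
  by apply: no; exists k.
have := uniq_leq_size (enum_uniq _) sub.
by rewrite size_enum_ord leqNgt n3.
Qed.

(** A diagonal matrix of determinant one that doubles coordinate [j], halves
    coordinate [k] and fixes [e_i] forces the [j]-th coordinate of [A e_i] to
    vanish; transitivity on nonzero vectors transports [A e_i = sigma e_i]
    to every vector. *)
Lemma SL_equivariant_scalar (A : 'rV[R]_n -> 'rV[R]_n) : (3 <= n)%N ->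
  (forall Q, \det Q = 1 -> forall y, A (y *m Q) = A y *m Q) ->
  exists sigma, forall y, A y = sigma *: y.
Proof.
move=> n3 AQ.
have fixA (y : 'rV[R]_n) (i j k : 'I_n) : j != k -> (forall l, l != i -> y ord0 l = 0) ->
    j != i -> k != i -> A y ord0 j = 0.
  move=> jk yi ji ki.
  pose Q := diag_mx (stretch j 2%:R) *m diag_mx (stretch k (2%:R^-1)) : 'M[R]_n.
  have dQ : \det Q = 1 by rewrite det_mulmx !det_stretch divff ?pnatr_eq0.
  have yQ : y *m Q = y.
    apply/rowP => l; rewrite mulmxA !mulmx_diag_entry !mxE.
    have [->|li] := eqVneq l i; last by rewrite yi// !mul0r.
    by rewrite eq_sym (negPf ji) eq_sym (negPf ki) !mulr1.
  have /rowP/(_ j) := AQ Q dQ y.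
  rewrite yQ mulmxA !mulmx_diag_entry !mxE eqxx (negPf jk) mulr1; lra.
have i : 'I_n by exact: Ordinal n3.
have [j [ji _]] := ord_avoid2 i i n3.
pose e : 'rV[R]_n := delta_mx ord0 i.
have eA : A e = A e ord0 i *: e.
  apply/rowP => l; rewrite !mxE eqxx /=; have [->|li] := eqVneq l i.
    by rewrite mulr1.
  have [k [ki kl]] := ord_avoid2 i l n3.
  rewrite mulr0; apply: (fixA _ i l k) => //; first by rewrite eq_sym.
  by move=> m mi; rewrite mxE (negPf mi) andbF.
exists (A e ord0 i) => y; have [->|y0] := eqVneq y 0.
  rewrite scaler0; apply/rowP => l.
  have [k [kl _]] := ord_avoid2 l l n3; have [m [mk ml]] := ord_avoid2 k l n3.
  rewrite [RHS]mxE; apply: (fixA _ m l k); rewrite 1?eq_sym//.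
  by move=> r _; rewrite mxE.
have [|Q dQ <-] := @SL_transitive i j y _ y0; first by rewrite eq_sym.
by rewrite AQ// {1}eA -scalemxAl.
Qed.

End special_linear.

(** * Cutting along hyperplanes *)

Section cutting.
Local Open Scope ereal_scope.
Context {R : realType} {n : nat}.
Implicit Types (u v : 'rV[R]_n -> \bar R) (f : 'rV[R]_n -> R) (x y z p : 'rV[R]_n).

Definition affine_fun f := continuous f /\ forall x y (t : R),
  (f (t *: x + (1 - t) *: y) = t * f x + (1 - t) * f y)%R.

Definition functional_valuation (V : ('rV[R]_n -> \bar R) -> R) :=
  forall u v, Conv_sc u -> Conv_sc v -> Conv_sc (u \max v) ->
  Conv_sc (u \min v) -> (V (u \max v) + V (u \min v) = V u + V v)%R.

Definition functional_continuous (V : ('rV[R]_n -> \bar R) -> R) :=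
  forall (us : nat -> 'rV[R]_n -> \bar R) u, (forall i, Conv_sc (us i)) ->
  Conv_sc u -> epi_cvg us u -> (fun i => V (us i)) @ \oo --> V u.

Lemma affine_closed_ge f : affine_fun f -> closed [set x | (0 <= f x)%R].
Proof.
move=> [fc _]; have -> : [set x | (0 <= f x)%R] = f @^-1` [set r | (0 <= r)%R] by [].
by apply: closed_comp; [move=> x _; exact: fc | exact: closed_ge].
Qed.

Lemma affine_convex_ge f : affine_fun f -> convex_set_rV [set x | (0 <= f x)%R].
Proof.
move=> [_ fa] x y t /andP[t0 t1] /= fx fy; rewrite fa.
by rewrite addr_ge0// mulr_ge0// subr_ge0.
Qed.

Lemma affineN f : affine_fun f -> affine_fun (fun x => - f x)%R.
Proof.
move=> [fc fa]; split=> [x|x y t]; last by rewrite fa; ring.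
apply: (@continuous_comp _ _ _ f (fun r => - r)%R x (fc x)).
by apply: cvgN; exact: cvg_id.
Qed.

Lemma affine_eq0E f : [set x | f x = 0%R] =
  [set x | (0 <= f x)%R] `&` [set x | (0 <= - f x)%R].
Proof.
apply/seteqP; split=> x /=; first by move=> ->; rewrite oppr0.
by rewrite oppr_ge0 => -[f0 f1]; apply/le_anti/andP.
Qed.

Lemma affine_closed_eq f : affine_fun f -> closed [set x | f x = 0%R].
Proof.
move=> af; rewrite affine_eq0E; apply: closedI; first exact: affine_closed_ge.
exact: (affine_closed_ge (affineN af)).
Qed.

Lemma affine_convex_eq f : affine_fun f -> convex_set_rV [set x | f x = 0%R].
Proof. by move=> [_ fa] x y t _ /= fx fy; rewrite fa fx fy !mulr0 addr0. Qed.

Lemma restrict_max u (A B : set 'rV[R]_n) : (forall x, u x != -oo) ->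
  restrict u A \max restrict u B = restrict u (A `&` B).
Proof.
move=> uN; apply/funext => x /=.
have [Ax|Ax] := pselect (A x); last first.
  by rewrite restrict_out// maxye restrict_out//; case.
have [Bx|Bx] := pselect (B x); last first.
  by rewrite (restrict_out _ Bx)// maxey restrict_out//; case.
by rewrite !restrict_in// maxxx.
Qed.

Lemma restrict_min u (A B : set 'rV[R]_n) : (forall x, u x != -oo) ->
  (forall x, A x \/ B x) -> restrict u A \min restrict u B = u.
Proof.
move=> uN AB; apply/funext => x /=.
have [Ax|Bx] := AB x; first by rewrite restrict_in// min_l// restrict_ge.
by rewrite (restrict_in _ Bx) min_r// restrict_ge.
Qed.

(** The two half-space restrictions of [u] have [u] as minimum and the
    restriction to the hyperplane as maximum. *)
Lemma valuation_cut (V : ('rV[R]_n -> \bar R) -> R) u f x0 :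
  functional_valuation V -> Conv_sc u -> affine_fun f ->
  f x0 = 0%R -> u x0 != +oo ->
  (V u + V (restrict u [set x | f x = 0%R]) =
   V (restrict u [set x | (0 <= f x)%R]) +
   V (restrict u [set x | (0 <= - f x)%R]))%R.
Proof.
move=> Vval cu af fx0 ux0; have af' := affineN af.
have uN x := Conv_sc_noNy x cu.
have cA : Conv_sc (restrict u [set x | (0 <= f x)%R]).
  apply: (Conv_sc_restrict (x0 := x0)) => //; first exact: affine_closed_ge.
    exact: affine_convex_ge.
  by rewrite /= fx0.
have cB : Conv_sc (restrict u [set x | (0 <= - f x)%R]).
  apply: (Conv_sc_restrict (x0 := x0)) => //; first exact: affine_closed_ge af'.
    exact: affine_convex_ge af'.
  by rewrite /= fx0 oppr0.
have AB x : [set x | (0 <= f x)%R] x \/ [set x | (0 <= - f x)%R] x.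
  by rewrite /= oppr_ge0; have [|/ltW] := leP 0%R (f x); [left|right].
have := Vval _ _ cA cB; rewrite restrict_max// restrict_min// -affine_eq0E.
rewrite addrC; apply=> //; apply: (Conv_sc_restrict (x0 := x0)) => //.
  exact: affine_closed_eq.
exact: affine_convex_eq.
Qed.

Lemma affine_norm_convex f (k : R) : (0 <= k)%R -> affine_fun f ->
  convex_fun (fun x => k * `|f x|)%R.
Proof.
move=> k0 [_ fa] x y t /andP[t0 t1]; rewrite fa !mulrA ![(_ * k)%R]mulrC -!mulrA.
rewrite -mulrDr ler_wpM2l// (le_trans (ler_normD _ _))// !normrM.
have t1' : (0 <= 1 - t)%R by rewrite subr_ge0.
by rewrite (ger0_norm t0) (ger0_norm t1').
Qed.

Lemma Conv_sc_add_norm u f (k : R) : Conv_sc u -> (0 <= k)%R -> affine_fun f ->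
  Conv_sc (fun x => u x + (k * `|f x|)%:E).
Proof.
move=> cu k0 af; apply: Conv_sc_add => //; last first.
- exists 0%R, 0%R => x; rewrite mul0r oppr0 addr0.
  by rewrite mulr_ge0.
- exact: affine_norm_convex.
case: af => fc _ x; apply: (@continuous_comp _ _ _ f (fun r => k * `|r|)%R x (fc x)).
by apply: cvgM; [exact: cvg_cst | apply: cvg_norm; exact: cvg_id].
Qed.

Lemma epi_cvg_add_norm u f : Conv_sc u -> affine_fun f ->
  epi_cvg (fun k x => u x + (k%:R * `|f x|)%:E) (restrict u [set x | f x = 0%R]).
Proof.
move=> cu af; have uN x := Conv_sc_noNy x cu; apply: epi_cvg_below.
- by move=> m; have [] := Conv_sc_add_norm cu (ler0n R m) af.
- by move=> m k x mk; rewrite leeD2l// lee_fin ler_wpM2r// ler_nat.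
- move=> k x; have [fx|fx] := pselect (f x = 0%R).
    by rewrite restrict_in// fx normr0 mulr0 adde0.
  by rewrite restrict_out// leey.
move=> x r; have [fx|fx] := pselect (f x = 0%R).
  by rewrite restrict_in//; exists 0%N; rewrite mul0r adde0.
move=> _; have fx0 : (0 < `|f x|)%R by rewrite normr_gt0; apply/eqP.
case: (u x) (uN x) => [s _|_|//]; last by exists 0%N; rewrite addye// ltry.
have [k rk] := nat_gt ((r - s) / `|f x|)%R; exists k.
by rewrite -EFinD lte_fin -ltrBlDl -ltr_pdivrMr.
Qed.

End cutting.

(** * Functionals invariant under adding affine functions *)

Section affine_invariant.
Local Open Scope ereal_scope.
Context {R : realType} {n : nat}.
Implicit Types (u v : 'rV[R]_n -> \bar R) (x y z p a : 'rV[R]_n).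
Context {V : ('rV[R]_n -> \bar R) -> R}.
Context (Vval : functional_valuation V) (Vcont : functional_continuous V).
Context (Vlin : forall u a, Conv_sc u -> V (addlin u a) = V u).
Context (Vcst : forall u (b : R), Conv_sc u -> V (fun x => u x + b%:E) = V u).

Lemma affine_dot a (b : R) : affine_fun (fun x => dot x a + b)%R.
Proof.
split=> [x|x y t]; last by rewrite dotDl !dotZl; ring.
apply: (@continuous_comp _ _ _ (fun z => dot z a) (fun r => r + b)%R x).
  exact: dot_continuous.
by apply: cvgD; [exact: cvg_id | exact: cvg_cst].
Qed.

Let Vaff u a (b : R) : Conv_sc u -> V (fun x => u x + (dot x a + b)%:E) = V u.
Proof.
move=> cu; rewrite -(Vlin a cu) -(Vcst b (Conv_sc_addlin a cu)).
by congr V; apply/funext => x; rewrite /addlin EFinD addeA.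
Qed.

(** On either side of the hyperplane [k |f|] is affine, so [V] takes the same
    value at [u + k |f|] as at [u]; these functions epi-converge to the
    restriction. *)
Lemma affine_invariant_restrict u a (b : R) x0 : Conv_sc u ->
  (dot x0 a + b = 0)%R -> u x0 != +oo ->
  V u = V (restrict u [set x | dot x a + b = 0]%R).
Proof.
move=> cu fx0 ux0; set f := (fun x => dot x a + b)%R.
have af : affine_fun f := affine_dot a b.
have uN x := Conv_sc_noNy x cu.
have Vk k : V (fun x => u x + (k%:R * `|f x|)%:E) = V u.
  have ck := Conv_sc_add_norm cu (ler0n R k) af.
  have cA : Conv_sc (restrict u [set x | (0 <= f x)%R]).
    apply: (Conv_sc_restrict (x0 := x0)) => //; first exact: affine_closed_ge.
      exact: affine_convex_ge.
    by rewrite /= /f fx0.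
  have cB : Conv_sc (restrict u [set x | (0 <= - f x)%R]).
    apply: (Conv_sc_restrict (x0 := x0)) => //; first exact: (affine_closed_ge (affineN af)).
      exact: (affine_convex_ge (affineN af)).
    by rewrite /= /f fx0 oppr0.
  have ukx0 : u x0 + (k%:R * `|f x0|)%:E != +oo.
    by rewrite /f fx0 normr0 mulr0 adde0.
  have := valuation_cut Vval ck af fx0 ukx0.
  have -> : restrict (fun x => u x + (k%:R * `|f x|)%:E) [set x | f x = 0%R] =
      restrict u [set x | f x = 0%R].
    apply/funext => x; have [fx|fx] := pselect (f x = 0%R).
      by rewrite !restrict_in// fx normr0 mulr0 adde0.
    by rewrite !restrict_out//; case: (u x) (uN x).
  have -> : restrict (fun x => u x + (k%:R * `|f x|)%:E) [set x | (0 <= f x)%R] =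
      (fun x => restrict u [set x | (0 <= f x)%R] x + (dot x (k%:R *: a) + k%:R * b)%:E).
    apply/funext => x; have [fx|fx] := pselect (0 <= f x)%R.
      rewrite !restrict_in// ger0_norm//; congr (_ + _%:E).
      by rewrite dotZr -mulrDr.
    by rewrite !restrict_out//; case: (u x) (uN x).
  have -> : restrict (fun x => u x + (k%:R * `|f x|)%:E) [set x | (0 <= - f x)%R] =
      (fun x => restrict u [set x | (0 <= - f x)%R] x +
        (dot x (- k%:R *: a) + - k%:R * b)%:E).
    apply/funext => x; have [fx|fx] := pselect (0 <= - f x)%R.
      rewrite !restrict_in// -normrN ger0_norm//; congr (_ + _%:E).
      by rewrite dotZr -mulrDr mulrN mulNr.
    by rewrite !restrict_out//; case: (u x) (uN x).
  rewrite !Vaff// -(valuation_cut Vval cu af fx0 ux0).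
  exact: addIr.
have cR : Conv_sc (restrict u [set x | f x = 0%R]).
  apply: (Conv_sc_restrict (x0 := x0)) => //; first exact: affine_closed_eq.
  exact: affine_convex_eq.
have := Vcont (fun k => Conv_sc_add_norm cu (ler0n R k) af) cR
  (epi_cvg_add_norm cu af).
under eq_fun do rewrite Vk.
by move=> /cvg_lim <- //; rewrite lim_cst.
Qed.

Lemma closed_set1_rV p : closed [set p].
Proof. by apply: accessible_closed_set1; apply: hausdorff_accessible. Qed.

Lemma convex_set1_rV p : convex_set_rV [set p].
Proof.
move=> x y t _ /= -> ->; rewrite -scalerDl (_ : t + (1 - t) = 1)%R ?scale1r//.
by ring.
Qed.

Lemma Conv_sc_indic1 p : Conv_sc (indic [set p]).
Proof.
apply: (@Conv_sc_indic _ _ _ p `|p|%R) => //; [exact: closed_set1_rV| |].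
  exact: convex_set1_rV.
by move=> x ->.
Qed.

(** Restrict to [x_i = p_i] for one coordinate after the other, then remove the
    remaining constant [u p]. *)
Lemma affine_invariant_point u p : Conv_sc u -> u p != +oo ->
  V u = V (indic [set p]).
Proof.
move=> cu up; have uN x := Conv_sc_noNy x cu.
pose C (k : nat) := [set x : 'rV[R]_n | forall i : 'I_n, (i < k)%N -> x ord0 i = p ord0 i].
have C0 : restrict u (C 0%N) = u by apply/funext => x; rewrite restrict_in.
have Cn : restrict u (C n) = (fun x => indic [set p] x + u p).
  apply/funext => x; have [->|xp] := pselect (x = p).
    by rewrite restrict_in// indic_in// add0e.
  rewrite restrict_out// ?indic_out ?addye//.
  by move=> Cx; apply: xp; apply/rowP => i; exact: Cx.
have CS k (kn : (k < n)%N) : C k.+1 = C k `&`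
    [set x | dot x (delta_mx ord0 (Ordinal kn)) + - p ord0 (Ordinal kn) = 0]%R.
  have dE x : dot x (delta_mx ord0 (Ordinal kn)) = x ord0 (Ordinal kn).
    rewrite /dot (bigD1 (Ordinal kn))//= mxE !eqxx mulr1 big1 ?addr0// => i ik.
    by rewrite mxE (negPf ik) andbF mulr0.
  apply/seteqP; split=> x /=; rewrite dE.
    move=> Cx; split; first by move=> i ik; apply: Cx; rewrite ltnW.
    by rewrite Cx ?subrr.
  move=> [Cx /eqP]; rewrite subr_eq0 => /eqP xk i; rewrite ltnS leq_eqVlt.
  move=> /orP[/eqP ik|]; last exact: Cx.
  by rewrite (_ : i = Ordinal kn)//; apply: val_inj.
have CI k : (k <= n)%N -> Conv_sc (restrict u (C k)) /\ V u = V (restrict u (C k)).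
  elim: k => [_|k IH kn]; first by rewrite C0.
  have [ck Vk] := IH (ltnW kn).
  set a : 'rV[R]_n := delta_mx ord0 (Ordinal kn).
  have fp : (dot p a + - p ord0 (Ordinal kn) = 0)%R.
    have : C k.+1 p by [].
    by rewrite (CS k kn) => -[].
  have upk : restrict u (C k) p != +oo by rewrite restrict_in.
  have -> : restrict u (C k.+1) = restrict (restrict u (C k))
      [set x | dot x a + - p ord0 (Ordinal kn) = 0]%R.
    rewrite (CS k kn); apply/funext => x; rewrite -/a.
    set B := [set x | _]; have [Bx|Bx] := pselect (B x); last first.
      rewrite (restrict_out (Conv_sc_noNy x ck) Bx) restrict_out//.
      by case.
    rewrite (restrict_in _ Bx); have [Cx|Cx] := pselect (C k x).
      by rewrite !restrict_in.
    by rewrite !restrict_out//; case=> Ckx; case: (Cx Ckx).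
  split; last by rewrite Vk; exact: affine_invariant_restrict fp upk.
  have af := affine_dot a (- p ord0 (Ordinal kn)).
  apply: (Conv_sc_restrict (x0 := p)) => //; first exact: (affine_closed_eq af).
  exact: (affine_convex_eq af).
have [_ ->] := CI n (leqnn n); rewrite Cn.
case: (u p) up (uN p) => // r _ _; apply: Vcst; exact: Conv_sc_indic1.
Qed.

End affine_invariant.

(** * Simplices and piecewise affine functions *)

Section rows.
Context {R : realType}.

(** Applied to the matrix of vertices, this replaces vertex [j] by a point of
    the edge from vertex [i] to vertex [j]. *)
Definition rowcomb m k (A : 'M[R]_(m, k)) (i j : 'I_m) (t : R) : 'M[R]_(m, k) :=
  \matrix_(a, b) (if a == j then t * A j b + (1 - t) * A i b else A a b).

Lemma det_rowcomb m (A : 'M[R]_m) (i j : 'I_m) t : i != j ->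
  \det (rowcomb A i j t) = t * \det A.
Proof.
move=> ij; pose C : 'M[R]_m := \matrix_(a, b) (if a == j then A i b else A a b).
rewrite (@determinant_multilinear _ _ _ A C j t (1 - t)).
- rewrite (@determinant_alternate _ _ C i j ij) ?mulr0 ?addr0// => b.
  by rewrite !mxE eqxx (negPf ij).
- by apply/rowP => b; rewrite !mxE eqxx.
- by apply/matrixP => a b; rewrite !mxE eq_sym (negPf (neq_lift _ _)).
- by apply/matrixP => a b; rewrite !mxE eq_sym (negPf (neq_lift _ _)).
Qed.

(** Barycentric coordinates with respect to the vertices changed by
    [rowcomb]. *)
Definition coordcomb m (l : 'rV[R]_m) (i j : 'I_m) (t : R) : 'rV[R]_m :=
  \row_k (if k == j then t^-1 * l ord0 j
          else if k == i then l ord0 i - (1 - t) / t * l ord0 j else l ord0 k).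

Lemma sum_coordcomb m (l a : 'I_m -> R) (i j : 'I_m) t : i != j -> t != 0 ->
  \sum_k (if k == j then t^-1 * l j else
          if k == i then l i - (1 - t) / t * l j else l k) *
         (if k == j then t * a j + (1 - t) * a i else a k) = \sum_k l k * a k.
Proof.
move=> ij t0; rewrite (bigD1 j)//= [in RHS](bigD1 j)//=.
rewrite (bigD1 i)//= [in X in _ = _ + X](bigD1 i)//= eqxx (negPf ij) eqxx !addrA.
congr (_ + _); first by field.
by apply: eq_bigr => k /andP[/negPf -> /negPf ->].
Qed.

Lemma coordcomb_mul m k (l : 'rV[R]_m) (A : 'M[R]_(m, k)) (i j : 'I_m) t :
  i != j -> t != 0 -> coordcomb l i j t *m rowcomb A i j t = l *m A.
Proof.
move=> ij t0; apply/rowP => b; rewrite !mxE.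
rewrite -(sum_coordcomb (fun k => l ord0 k) (fun k => A k b) ij t0).
by apply: eq_bigr => a _; rewrite !mxE.
Qed.

(** The values at the vertices changed by [rowcomb] of the affine function with
    values [a] at the original vertices. *)
Definition valcomb m (a : 'rV[R]_m) (i j : 'I_m) (t : R) : 'rV[R]_m :=
  \row_k (if k == j then t * a ord0 j + (1 - t) * a ord0 i else a ord0 k).

Lemma coordcomb_dot m (l a : 'rV[R]_m) (i j : 'I_m) t :
  i != j -> t != 0 -> dot (coordcomb l i j t) (valcomb a i j t) = dot l a.
Proof.
move=> ij t0; rewrite /dot.
rewrite -(sum_coordcomb (fun k => l ord0 k) (fun k => a ord0 k) ij t0).
by apply: eq_bigr => k _; rewrite !mxE.
Qed.

Lemma dot_delta m (x : 'rV[R]_m) (k : 'I_m) : dot x (delta_mx ord0 k) = x ord0 k.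
Proof.
rewrite /dot (bigD1 k)//= mxE !eqxx mulr1 big1 ?addr0// => i ik.
by rewrite mxE (negPf ik) andbF mulr0.
Qed.

(** The maximum of the affine functions with vertex values [a] and [al], as a
    function of barycentric coordinates. *)
Fixpoint maxaff m (a : 'rV[R]_m) (al : seq 'rV[R]_m) (l : 'rV[R]_m) : R :=
  if al is b :: al' then Num.max (dot l b) (maxaff a al' l) else dot l a.

End rows.

Section simplices.
Context {R : realType} {n : nat}.
Implicit Types (p : 'M[R]_(n + 1, n)) (x : 'rV[R]_n) (a b l : 'rV[R]_(n + 1)).

Definition hom x : 'rV[R]_(n + 1) := row_mx x (const_mx 1).
(** The vertices in homogeneous coordinates; they span a nondegenerate simplex
    exactly when this matrix is invertible, and its determinant is a multiple
    of the oriented volume. *)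
Definition vmat p : 'M[R]_(n + 1) := row_mx p (const_mx 1).
Definition bary p x : 'rV[R]_(n + 1) := hom x *m invmx (vmat p).
Definition simplex p : set 'rV[R]_n := [set x | forall i, 0 <= bary p x ord0 i].

Lemma mul_vmat l p : l *m vmat p = row_mx (l *m p) (const_mx (\sum_i l ord0 i)).
Proof.
rewrite mul_mx_row; congr row_mx; apply/rowP => j; rewrite !mxE.
by apply: eq_bigr => i _; rewrite mxE mulr1.
Qed.

Lemma baryK p x : vmat p \in unitmx -> bary p x *m vmat p = hom x.
Proof. by move=> pu; rewrite mulmxKV. Qed.

Lemma bary_mul p x : vmat p \in unitmx -> bary p x *m p = x.
Proof. by move=> /(baryK x); rewrite mul_vmat => /eq_row_mx[]. Qed.

Lemma bary_sum p x : vmat p \in unitmx -> \sum_i bary p x ord0 i = 1.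
Proof.
move=> /(baryK x); rewrite mul_vmat => /eq_row_mx[_ /rowP/(_ ord0)].
by rewrite !mxE.
Qed.

Lemma bary_uniq p x l : vmat p \in unitmx -> l *m vmat p = hom x -> bary p x = l.
Proof. by move=> pu lp; rewrite /bary -lp mulmxK. Qed.

Lemma bary_vertex p i : vmat p \in unitmx -> bary p (row i p) = delta_mx ord0 i.
Proof.
move=> pu; apply: bary_uniq => //; rewrite mul_vmat -rowE; congr row_mx.
apply/rowP => j; rewrite !mxE (bigD1 i)//= mxE !eqxx big1 ?addr0// => k ki.
by rewrite mxE (negPf ki) andbF.
Qed.

Lemma bary_affine p a : exists (c : 'rV[R]_n) (d : R),
  forall x, dot (bary p x) a = dot x c + d.
Proof.
pose M := invmx (vmat p).
exists (a *m (usubmx M)^T), (dot ((const_mx 1 : 'rV[R]_1) *m dsubmx M) a) => x.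
rewrite /bary /hom -/M -{1}(vsubmxK M) mul_row_col dotDl; congr (_ + _).
rewrite /dot; under eq_bigr do rewrite mxE mulr_suml.
rewrite exchange_big /=; apply: eq_bigr => i _; rewrite mxE mulr_sumr.
by apply: eq_bigr => j _; rewrite !mxE; ring.
Qed.

Lemma bary_affine_fun p a : affine_fun (fun x => dot (bary p x) a).
Proof.
have [c [d cd]] := bary_affine p a.
have -> : (fun x => dot (bary p x) a) = (fun x => dot x c + d) by apply/funext.
exact: affine_dot.
Qed.

Lemma maxaff_ge a al l : dot l a <= maxaff a al l.
Proof. by elim: al => [|b al IH] //=; rewrite le_max IH orbT. Qed.

Lemma maxaff_continuous p a al : continuous (fun x => maxaff a al (bary p x)).
Proof.
elim: al => [|b al IH] /=; first by have [] := bary_affine_fun p a.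
move=> x; apply: (@continuous_max _ _ (fun x => dot (bary p x) b)
  (fun x => maxaff a al (bary p x))); last exact: IH.
by have [fc _] := bary_affine_fun p b; exact: fc.
Qed.

Lemma maxaff_convex p a al : convex_fun (fun x => maxaff a al (bary p x)).
Proof.
move=> x y t t01; have [t0 t1] : 0 <= t /\ 0 <= 1 - t.
  by case/andP: t01 => ? ?; rewrite subr_ge0.
elim: al => [|b al IH] /=; first by have [_ ->] := bary_affine_fun p a.
have [_ fb] := bary_affine_fun p b.
rewrite ge_max fb lerD ?ler_wpM2l ?le_max ?lexx//=.
by apply: le_trans IH _; rewrite lerD// ler_wpM2l// le_max lexx orbT.
Qed.

Lemma simplex_closed p : closed (simplex p).
Proof.
have -> : simplex p = \bigcap_(i in setT)
    [set x | 0 <= dot (bary p x) (delta_mx ord0 i)].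
  apply/seteqP; split=> x px i; first by rewrite /= dot_delta.
  by have := px i I; rewrite /= dot_delta.
by apply: closed_bigI => i _; exact: (affine_closed_ge (bary_affine_fun p _)).
Qed.

Lemma simplex_convex p : convex_set_rV (simplex p).
Proof.
move=> x y t t01 px py i; rewrite -dot_delta.
apply: (affine_convex_ge (bary_affine_fun p _)) => //=; rewrite dot_delta.
  exact: px.
exact: py.
Qed.

Lemma simplex_vertex p i : vmat p \in unitmx -> simplex p (row i p).
Proof.
by move=> pu k; rewrite bary_vertex// mxE; case: (_ && _).
Qed.

Lemma bary_le1 p x i : vmat p \in unitmx -> simplex p x -> bary p x ord0 i <= 1.
Proof.
move=> pu px; rewrite -(bary_sum x pu) (bigD1 i)//= lerDl.
by apply: sumr_ge0 => k _; exact: px.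
Qed.

Lemma simplex_bounded p x : vmat p \in unitmx -> simplex p x ->
  `|x| <= (n + 1)%:R * `|p|.
Proof.
move=> pu px; rewrite -{1}(bary_mul x pu) (le_trans (norm_mulmx _ _))//.
rewrite ler_piMr ?mulr_ge0//; apply: norm_le_coord => // i.
by rewrite ger0_norm ?px// bary_le1.
Qed.

Lemma vmat_rowcomb p i j t : vmat (rowcomb p i j t) = rowcomb (vmat p) i j t.
Proof.
apply/matrixP => k b; rewrite !mxE; case: (fintype.split b) => c; rewrite !mxE//.
by case: (k == j) => //; ring.
Qed.

Lemma rowcomb_unit p i j t : i != j -> t != 0 -> vmat p \in unitmx ->
  vmat (rowcomb p i j t) \in unitmx.
Proof.
move=> ij t0; rewrite !unitmxE vmat_rowcomb det_rowcomb// unitrM => ->.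
by rewrite unitfE t0.
Qed.

Lemma bary_rowcomb p x i j t : i != j -> t != 0 -> vmat p \in unitmx ->
  bary (rowcomb p i j t) x = coordcomb (bary p x) i j t.
Proof.
move=> ij t0 pu; apply: bary_uniq; first exact: rowcomb_unit.
by rewrite vmat_rowcomb coordcomb_mul// baryK.
Qed.

(** The vertex values of an affine function that vanishes at the new point
    [(1 - t) p_i + t p_j] and at all vertices but [p_i] and [p_j]. *)
Definition cutfun (i j : 'I_(n + 1)) (t : R) : 'rV[R]_(n + 1) :=
  t *: delta_mx ord0 i - (1 - t) *: delta_mx ord0 j.

Lemma dot_cutfun l i j t : dot l (cutfun i j t) = t * l ord0 i - (1 - t) * l ord0 j.
Proof. by rewrite dotDr dotNr !dotZr !dot_delta. Qed.

Lemma simplex_rowcomb p i j t : i != j -> 0 < t < 1 -> vmat p \in unitmx ->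
  simplex (rowcomb p i j t) = simplex p `&` [set x | 0 <= dot (bary p x) (cutfun i j t)].
Proof.
move=> ij /andP[t0 t1] pu; have tn0 : t != 0 by rewrite gt_eqF.
have s0 : 0 < 1 - t by rewrite subr_gt0.
apply/seteqP; split=> x; rewrite /simplex /= ?bary_rowcomb// dot_cutfun.
- move=> lx.
  have lj : 0 <= bary p x ord0 j.
    have := lx j; rewrite mxE eqxx pmulr_rge0// invr_gt0//.
  have li := lx i; rewrite mxE (negPf ij) eqxx in li.
  have fi : 0 <= t * bary p x ord0 i - (1 - t) * bary p x ord0 j.
    have := mulr_ge0 (ltW t0) li; rewrite mulrBr mulrA (mulrCA t) divff// mulr1.
    by [].
  split=> // k; have [->//|kj] := eqVneq k j; have [->|ki] := eqVneq k i.
    by rewrite -(pmulr_rge0 _ t0); have := mulr_ge0 (ltW s0) lj; lra.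
  by have := lx k; rewrite mxE (negPf kj) (negPf ki).
move=> [lx fx] k; rewrite mxE; case: eqP => _.
  by rewrite mulr_ge0// invr_ge0 ltW.
case: eqP => // _; rewrite -(pmulr_rge0 _ t0) mulrBr mulrA (mulrCA t) divff// mulr1.
by [].
Qed.

Lemma maxaff_comb a al l i j t : i != j -> t != 0 ->
  maxaff (valcomb a i j t) [seq valcomb b i j t | b <- al] (coordcomb l i j t) =
  maxaff a al l.
Proof.
move=> ij t0; elim: al => [|b al IH] /=; first exact: coordcomb_dot.
by rewrite coordcomb_dot// IH.
Qed.

Definition pwaff p a al : 'rV[R]_n -> \bar R :=
  fun x => (indic (simplex p) x + (maxaff a al (bary p x))%:E)%E.

Lemma maxaff_bound p a al : exists C D, forall x,
  - (C * `|x|) - D <= maxaff a al (bary p x).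
Proof.
have [c [d cd]] := bary_affine p a; have [C [D CD]] := ell_bound c.
exists C, (D + `|d|) => x; apply: le_trans (maxaff_ge _ _ _); rewrite cd.
have := CD x; rewrite /ell; have := ler_norm (- d); rewrite normrN; lra.
Qed.

Lemma Conv_sc_indic_simplex p : vmat p \in unitmx -> Conv_sc (indic (simplex p)).
Proof.
move=> pu; have i : 'I_(n + 1) by apply: (@Ordinal _ 0); rewrite addn1.
apply: (@Conv_sc_indic _ _ _ (row i p) ((n + 1)%:R * `|p|)).
- exact: simplex_closed.
- exact: simplex_convex.
- exact: simplex_vertex.
by move=> x; exact: simplex_bounded.
Qed.

Lemma Conv_sc_pwaff p a al : vmat p \in unitmx -> Conv_sc (pwaff p a al).
Proof.
move=> pu; apply: Conv_sc_add; first exact: Conv_sc_indic_simplex.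
- exact: maxaff_continuous.
- exact: maxaff_convex.
exact: maxaff_bound.
Qed.

Lemma pwaff_in p a al x : simplex p x -> pwaff p a al x = (maxaff a al (bary p x))%:E.
Proof. by move=> px; rewrite /pwaff indic_in// add0e. Qed.

Lemma pwaff_out p a al x : ~ simplex p x -> pwaff p a al x = +oo%E.
Proof. by move=> px; rewrite /pwaff indic_out// addye. Qed.

Lemma pwaff_cut p a al i j t : i != j -> 0 < t < 1 -> vmat p \in unitmx ->
  restrict (pwaff p a al) [set x | 0 <= dot (bary p x) (cutfun i j t)] =
  pwaff (rowcomb p i j t) (valcomb a i j t) [seq valcomb b i j t | b <- al].
Proof.
move=> ij t01 pu; have t0 : t != 0 by case/andP: t01 => /gt_eqF ->.
apply/funext => x; set B := [set x | _].
have [px|px] := pselect (simplex (rowcomb p i j t) x).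
  rewrite pwaff_in//; move: px; rewrite simplex_rowcomb// => -[px Bx].
  by rewrite restrict_in// pwaff_in// bary_rowcomb// maxaff_comb.
rewrite pwaff_out//; have [Bx|Bx] := pselect (B x); last first.
  by rewrite restrict_out// Conv_sc_noNy//; exact: Conv_sc_pwaff.
rewrite restrict_in// pwaff_out// => sx; apply: px.
by rewrite simplex_rowcomb.
Qed.

(** The affine map carrying the vertices of [p] to those of [p'] has as
    determinant the quotient of those of the vertex matrices. *)
Lemma pwaff_affine_eq p p' : \det (vmat p) = \det (vmat p') -> vmat p \in unitmx ->
  exists2 Q : 'M[R]_n, \det Q = 1 & exists y : 'rV[R]_n,
    forall a al x, pwaff p a al x = pwaff p' a al (x *m Q + y).
Proof.
move=> dpp' pu; have pu' : vmat p' \in unitmx by rewrite unitmxE -dpp' -unitmxE.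
pose M := invmx (vmat p) *m vmat p'.
have Mblock : M = block_mx (usubmx (lsubmx M)) 0 (dsubmx (lsubmx M)) (const_mx 1).
  have E : invmx (vmat p) *m const_mx 1 = col_mx 0 (const_mx 1) :> 'M[R]_(n + 1, 1).
    have := mulVmx pu; rewrite {2}/vmat mul_mx_row scalar_mx_block block_mxEh.
    move=> /eq_row_mx[_ ->]; congr col_mx; apply/matrixP => k m.
    by rewrite !ord1 !mxE.
  rewrite block_mxEh vsubmxK -E {2}/M /vmat mul_mx_row row_mxKl.
  by rewrite /M /vmat mul_mx_row.
set Q := usubmx (lsubmx M) in Mblock; set y := dsubmx (lsubmx M) in Mblock.
have dQ : \det Q = 1.
  have : \det M = 1.
    by rewrite det_mulmx det_inv dpp' mulVr// -unitmxE.
  rewrite Mblock det_lblock (_ : const_mx 1 = 1%:M) ?det1 ?mulr1//.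
  by apply/matrixP => k m; rewrite !ord1 !mxE.
have one : (const_mx 1 : 'M[R]_1) = 1%:M.
  by apply/matrixP => k m; rewrite !ord1 !mxE.
exists Q => //; exists y => a al x.
have homE : hom x *m M = hom (x *m Q + y).
  rewrite Mblock /hom mul_row_block mulmx0 add0r; congr row_mx.
    by rewrite one mul1mx.
  by rewrite one mulmx1.
have baryE : bary p' (x *m Q + y) = bary p x.
  by rewrite /bary -homE /M -!mulmxA mulmxV// mulmx1.
have sE : simplex p' (x *m Q + y) = simplex p x by rewrite /simplex /= baryE.
have [px|px] := pselect (simplex p x).
  by rewrite !pwaff_in ?sE// baryE.
by rewrite !pwaff_out ?sE.
Qed.

End simplices.

(** * Functionals invariant under volume-preserving affine maps *)

Section scaling.
Local Open Scope ereal_scope.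
Context {R : realType} {n : nat}.
Implicit Types (u v : 'rV[R]_n -> \bar R) (x y a : 'rV[R]_n).

(** In coordinates where the hyperplane is [x_i = 0] the map is diagonal, with
    entries [K] on the hyperplane and [K ^- (n - 1)] across it. *)
Lemma hyperplane_stretch a (K : R) : (2 <= n)%N -> a != 0%R -> K != 0%R ->
  exists2 Q : 'M[R]_n, \det Q = 1%R &
    forall x, (dot x a = 0 -> x *m Q = K *: x)%R /\
              (dot x a != 0 -> dot (x *m Q) a != 0)%R.
Proof.
move=> n2 a0 K0; have n0 : (0 < n)%N by exact: ltnW.
pose i : 'I_n := Ordinal n0; pose j : 'I_n := Ordinal n2.
have ij : i != j by [].
have [G dG Ga] := SL_transitive ij a0.
have Gu : G^T \in unitmx by rewrite unitmx_tr unitmxE dG unitr1.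
pose d : 'rV[R]_n := \row_k (if k == i then (K ^+ n.-1)^-1 else K)%R.
have dx x : dot x a = (x *m G^T)%R ord0 i.
  by rewrite -dot_delta dot_mulmx trmxK Ga.
have QG x : (x *m (G^T *m diag_mx d *m invmx G^T) *m G^T = x *m G^T *m diag_mx d)%R.
  by rewrite !mulmxA mulmxKV.
exists (G^T *m diag_mx d *m invmx G^T)%R.
  rewrite !det_mulmx det_inv det_tr dG invr1 mul1r mulr1 det_diag (bigD1 i)//= mxE eqxx.
  rewrite (eq_bigr (fun=> K)) => [|k ki]; last by rewrite mxE (negPf ki).
  by rewrite prodr_const cardC1 card_ord mulVf// expf_neq0.
move=> x; split.
  rewrite dx => x0; apply: (can_inj (mulmxK Gu)); rewrite QG -scalemxAl.
  apply/rowP => k; rewrite mulmx_diag_entry !mxE.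
  have [->|ki] := eqVneq k i; last by rewrite mulrC.
  by move: x0; rewrite mxE => ->; rewrite mulr0 mul0r.
rewrite !dx QG mulmx_diag_entry => h; rewrite mulf_neq0//.
by rewrite mxE eqxx invr_neq0// expf_neq0.
Qed.

(** By convexity [u (K x)] increases with [K] when [u] has its minimum at the
    origin, and by coercivity it tends to infinity off the origin. *)
Lemma epi_cvg_blowup u (m : R) : Conv_sc u -> u 0%R = m%:E ->
  (forall x, m%:E <= u x) ->
  epi_cvg (fun k x => u (k.+1%:R *: x)%R) (fun x => indic [set 0%R] x + m%:E).
Proof.
move=> cu u0 um.
have ck (k : nat) : Conv_sc (fun x => u (k.+1%:R *: x)%R).
  have := @Conv_sc_comp _ _ u (k.+1%:R%:M)%R 0%R _ cu.
  under eq_fun do rewrite addr0 mul_mx_scalar.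
  by apply; rewrite unitmxE det_scalar unitfE expf_neq0// pnatr_eq0.
have /Conv_scP[_ uc _ ug] := cu.
apply: epi_cvg_below.
- by move=> k; have [] := ck k.
- move=> k k' x kk'; case uE : (u (k'.+1%:R *: x)%R) => [r| |]; last 2 first.
  + by rewrite leey.
  + by move: (um (k'.+1%:R *: x)%R); rewrite uE leeNy_eq.
  pose t : R := (k.+1%:R / k'.+1%:R)%R.
  have t01 : (0 <= t <= 1)%R.
    by rewrite divr_ge0//= ler_pdivrMr// mul1r ler_nat ltnS.
  rewrite (_ : k.+1%:R *: x = t *: (k'.+1%:R *: x) + (1 - t) *: 0)%R; last first.
    by rewrite scaler0 addr0 scalerA mulfVK// pnatr_eq0.
  apply: convex_ereal_le => //; first by rewrite uE.
  by rewrite u0 -uE um.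
- move=> k x; have [->|x0] := pselect (x = 0%R).
    by rewrite scaler0 u0 indic_in// add0e.
  by rewrite indic_out// addye// leey.
move=> x r; have [->|/eqP x0] := pselect (x = 0%R).
  by rewrite indic_in// add0e => rm; exists 0%N; rewrite scaler0 u0.
move=> _; have [b ub] := ug 1%R.
have nx : (0 < `|x|)%R by rewrite normr_gt0.
have [k rk] := nat_gt ((r - b) / `|x|)%R; exists k.
apply: lt_le_trans (ub _); rewrite lte_fin mul1r normrZ ger0_norm// -ltrBlDr.
by rewrite -ltr_pdivrMr// (lt_le_trans rk)// ler_nat.
Qed.

End scaling.

Section constancy.
Local Open Scope ereal_scope.
Context {R : realType} {n : nat}.
Implicit Types (u v : 'rV[R]_n -> \bar R) (x y : 'rV[R]_n).
Implicit Types (p q : 'M[R]_(n + 1, n)) (a b : 'rV[R]_(n + 1)).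
Context (n_ge2 : (2 <= n)%N).
Context {V : ('rV[R]_n -> \bar R) -> R}.
Context (Vval : functional_valuation V) (Vcont : functional_continuous V).
Context (Vsl : forall u (Q : 'M[R]_n), Conv_sc u -> \det Q = 1%R ->
  V (fun x => u (x *m Q)) = V u).
Context (Vtr : forall u y, Conv_sc u -> V (fun x => u (x + y)%R) = V u).
Context (Vcst : forall u (b : R), Conv_sc u -> V (fun x => u x + b%:E) = V u).

Definition atom : R := V (indic [set 0%R]).

(** After a translation that puts a minimizer at the origin, stretching the
    hyperplane by [K] composes [u] with [x -> K x], whose epi-limit is the
    indicator of the origin up to a constant. *)
Lemma valuation_hyperplane u (d : 'rV[R]_n) (b : R) : Conv_sc u -> d != 0%R ->
  (forall x, u x != +oo -> (dot x d + b = 0)%R) -> V u = atom.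
Proof.
move=> cu d0 ud; have [x0 [m [ux0 um]]] := Conv_sc_fin_min cu.
pose w x := u (x + x0)%R.
have cw : Conv_sc w.
  have := @Conv_sc_comp _ _ u 1%:M%R x0 (unitmx1 _ _) cu.
  by under eq_fun do rewrite mulmx1.
have w0 : w 0%R = m%:E by rewrite /w add0r.
have wm x : m%:E <= w x by exact: um.
have wd x : w x != +oo -> (dot x d = 0)%R.
  move=> /ud; rewrite dotDl.
  have : (dot x0 d + b = 0)%R by apply: ud; rewrite ux0.
  lra.
have Vk (k : nat) : V (fun x => w (k.+1%:R *: x)%R) = V w.
  have [|Q dQ Qx] := @hyperplane_stretch _ n d k.+1%:R n_ge2 d0.
    by rewrite pnatr_eq0.
  rewrite -(Vsl cw dQ); congr V; apply/funext => x.
  have [Q1 Q2] := Qx x; have [xd|xd] := eqVneq (dot x d) 0%R; first by rewrite Q1.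
  have wo z : dot z d != 0%R -> w z = +oo.
    by move=> zd; apply/eqP/negPn/negP => /wd /eqP; rewrite (negPf zd).
  by rewrite !wo// ?Q2// dotZl mulf_neq0// pnatr_eq0.
have ck (k : nat) : Conv_sc (fun x => w (k.+1%:R *: x)%R).
  have := @Conv_sc_comp _ _ w (k.+1%:R%:M)%R 0%R _ cw.
  under eq_fun do rewrite addr0 mul_mx_scalar.
  by apply; rewrite unitmxE det_scalar unitfE expf_neq0// pnatr_eq0.
have c0 := Conv_sc_indic1 (0%R : 'rV[R]_n).
have := Vcont ck (Conv_sc_addc m c0) (epi_cvg_blowup cw w0 wm).
under eq_fun do rewrite Vk.
rewrite Vcst// /w Vtr// => /cvg_lim; rewrite lim_cst// => E.
exact: E.
Qed.

(** The part of [V] that the functions with lower-dimensional domain do not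
    see; it is additive under hyperplane cuts. *)
Definition excess p a (al : seq 'rV[R]_(n + 1)) : R := (V (pwaff p a al) - atom)%R.

Lemma excess_cut p a al (i j : 'I_(n + 1)) t : i != j -> (0 < t < 1)%R ->
  vmat p \in unitmx ->
  (excess p a al =
   excess (rowcomb p i j t) (valcomb a i j t) [seq valcomb b i j t | b <- al] +
   excess (rowcomb p j i (1 - t)) (valcomb a j i (1 - t))
          [seq valcomb b j i (1 - t) | b <- al])%R.
Proof.
move=> ij t01 pu; have ji : j != i by rewrite eq_sym.
have t0 : t != 0%R by case/andP: t01 => /gt_eqF ->.
have t01' : (0 < 1 - t < 1)%R by case/andP: t01 => ? ?; apply/andP; split; lra.
have cp := Conv_sc_pwaff a al pu.
pose f x := dot (bary p x) (cutfun i j t).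
have af : affine_fun f := bary_affine_fun p _.
pose x0 := row j (rowcomb p i j t).
have pu' := rowcomb_unit ij t0 pu.
have bx0 : bary (rowcomb p i j t) x0 = delta_mx ord0 j by rewrite bary_vertex.
have /simplex_rowcomb sE := pu.
have sx0 := simplex_vertex j pu'; rewrite sE// in sx0.
have bx0' : (coordcomb (bary p x0) i j t = delta_mx ord0 j)%R.
  by rewrite -bary_rowcomb.
have fx0 : f x0 = 0%R.
  have h : coordcomb (bary p x0) i j t ord0 i = 0%R.
    by rewrite bx0' mxE (negPf ij) andbF.
  rewrite mxE (negPf ij) eqxx in h; rewrite /f dot_cutfun.
  have -> : (t * bary p x0 ord0 i - (1 - t) * bary p x0 ord0 j =
    t * (bary p x0 ord0 i - (1 - t) / t * bary p x0 ord0 j))%R by field.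
  by rewrite h mulr0.
have ux0 : pwaff p a al x0 != +oo by rewrite pwaff_in//; case: sx0.
have := valuation_cut Vval cp af fx0 ux0.
rewrite pwaff_cut//.
have -> : [set x | (0 <= - f x)%R] = [set x | (0 <= dot (bary p x) (cutfun j i (1 - t)))%R].
  apply/seteqP; split=> x /=; rewrite /f !dot_cutfun => h; lra.
rewrite pwaff_cut//.
have [d [b fE]] := bary_affine p (cutfun i j t).
have -> : V (restrict (pwaff p a al) [set x | f x = 0%R]) = atom.
  apply: (@valuation_hyperplane _ d b).
  - apply: (Conv_sc_restrict (x0 := x0)) => //; first exact: affine_closed_eq.
    exact: affine_convex_eq.
  - apply/eqP => d0.
    have : f (row i p) = f (row j p) by rewrite /f !fE d0 !dot0r.
    rewrite /f !dot_cutfun !bary_vertex// !mxE !eqxx /= (negPf ij) (negPf ji).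
    by case/andP: t01 => t0' t1'; rewrite !mulr1 !mulr0; lra.
  move=> x; have [fx|fx] := pselect (f x = 0%R); first by rewrite -fE.
  by rewrite restrict_out ?eqxx// Conv_sc_noNy.
rewrite /excess; lra.
Qed.

Lemma excess_det p q a al : \det (vmat p) = \det (vmat q) -> vmat p \in unitmx ->
  excess p a al = excess q a al.
Proof.
move=> dpq pu; have qu : vmat q \in unitmx by rewrite unitmxE -dpq -unitmxE.
have [Q dQ [y E]] := pwaff_affine_eq dpq pu.
have cq := Conv_sc_pwaff a al qu.
have cq' : Conv_sc (fun z => pwaff q a al (z + y)%R).
  have := @Conv_sc_comp _ _ _ 1%:M%R y (unitmx1 _ _) cq.
  by under eq_fun do rewrite mulmx1.
rewrite /excess; congr (_ - _)%R; rewrite -(Vtr y cq) -(Vsl cq' dQ).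
by congr V; apply/funext => x; rewrite E.
Qed.

Lemma excess_shift p a (s : R) : vmat p \in unitmx ->
  excess p (a + const_mx s)%R [::] = excess p a [::].
Proof.
move=> pu; rewrite /excess -(Vcst s (Conv_sc_pwaff a [::] pu)).
congr (V _ - _)%R; apply/funext => x; rewrite /pwaff -addeA -EFinD /=.
congr (_ + _%:E); rewrite dotDr; congr (_ + _)%R.
have cE i : (const_mx s : 'rV[R]_(n + 1)) ord0 i = s by rewrite mxE.
rewrite /dot; under eq_bigr do rewrite cE.
by rewrite -mulr_suml bary_sum// mul1r.
Qed.

Let half01 : (0 < (2^-1 : R) < 1)%R.
Proof. by apply/andP; split; lra. Qed.

Let half_sub : (1 - (2^-1 : R) = 2^-1)%R.
Proof. by lra. Qed.

(** Halving the edge joining two vertices of equal value produces two simplices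
    of half the volume carrying the original vertex values. *)
Lemma excess_half_tie p q a (i j : 'I_(n + 1)) : i != j -> a ord0 i = a ord0 j ->
  vmat p \in unitmx -> (\det (vmat q) = 2^-1 * \det (vmat p))%R ->
  excess q a [::] = (2^-1 * excess p a [::])%R.
Proof.
move=> ij aij pu dq; have ji : j != i by rewrite eq_sym.
have vE (k l : 'I_(n + 1)) : a ord0 k = a ord0 l -> valcomb a k l (2^-1)%R = a.
  move=> akl; apply/rowP => m; rewrite mxE; case: eqP => // ->.
  by rewrite akl; lra.
have qu : vmat q \in unitmx.
  by rewrite unitmxE dq unitrM -unitmxE pu unitfE invr_neq0// pnatr_eq0.
rewrite (excess_cut a [::] ij half01 pu) /= half_sub !vE//.
rewrite -(@excess_det q (rowcomb p i j 2^-1)%R)//; last first.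
  by rewrite vmat_rowcomb det_rowcomb.
rewrite -(@excess_det q (rowcomb p j i 2^-1)%R)//; last first.
  by rewrite vmat_rowcomb det_rowcomb.
by lra.
Qed.

Lemma ord_three_sorted (a : 'rV[R]_(n + 1)) : exists i j k : 'I_(n + 1),
  [/\ i != j, i != k, k != j & (a ord0 i <= a ord0 k <= a ord0 j)%R].
Proof.
have n3 : (3 <= n + 1)%N by rewrite addn1.
pose x : 'I_(n + 1) := Ordinal (ltnW (ltnW n3)).
pose y : 'I_(n + 1) := Ordinal (ltnW n3).
pose z : 'I_(n + 1) := Ordinal n3.
case: (lerP (a ord0 x) (a ord0 y)) => xy; case: (lerP (a ord0 y) (a ord0 z)) => yz;
  case: (lerP (a ord0 x) (a ord0 z)) => xz.
- by exists x, z, y; split=> //; rewrite xy yz.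
- by exists x, z, y; split=> //; rewrite xy yz.
- by exists x, y, z; split=> //; rewrite xz ltW.
- by exists z, y, x; split=> //; rewrite xy ltW.
- by exists y, z, x; split=> //; rewrite xz ltW.
- by exists y, x, z; split=> //; rewrite yz ltW.
- by exfalso; move: (lt_trans yz xy); rewrite ltNge xz.
- by exists z, x, y; split=> //; rewrite !ltW.
Qed.

(** Choose vertices with values [a_i <= a_k <= a_j] and cut the edge from [i]
    to [j] where the value is [a_k]: both pieces have two equal vertex values, so
    the previous case applies to them. *)
Lemma excess_half p q a : vmat p \in unitmx ->
  (\det (vmat q) = 2^-1 * \det (vmat p))%R ->
  excess q a [::] = (2^-1 * excess p a [::])%R.
Proof.
move=> pu dq; have [i [j [k [ij ik kj /andP[aik akj]]]]] := ord_three_sorted a.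
have ji : j != i by rewrite eq_sym.
have qu : vmat q \in unitmx.
  by rewrite unitmxE dq unitrM -unitmxE pu unitfE invr_neq0// pnatr_eq0.
have [aik'|aik'] := eqVneq (a ord0 i) (a ord0 k).
  exact: (excess_half_tie ik aik').
have [akj'|akj'] := eqVneq (a ord0 k) (a ord0 j).
  exact: (excess_half_tie kj akj').
have {}aik : (a ord0 i < a ord0 k)%R by rewrite lt_neqAle aik'.
have {}akj : (a ord0 k < a ord0 j)%R by rewrite lt_neqAle akj'.
have aij : (0 < a ord0 j - a ord0 i)%R by lra.
pose t := ((a ord0 k - a ord0 i) / (a ord0 j - a ord0 i))%R.
have t01 : (0 < t < 1)%R.
  apply/andP; split; first by rewrite divr_gt0// subr_gt0.
  by rewrite ltr_pdivrMr// mul1r; lra.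
have t0 : t != 0%R by case/andP: t01 => /gt_eqF ->.
have t1 : (1 - t)%R != 0%R by case/andP: t01 => _ ?; rewrite subr_eq0 gt_eqF.
have tk : (t * a ord0 j + (1 - t) * a ord0 i = a ord0 k)%R.
  by rewrite /t; field; rewrite gt_eqF.
rewrite (excess_cut a [::] ij t01 pu) (excess_cut a [::] ij t01 qu) /= mulrDr.
congr (_ + _)%R.
  apply: (@excess_half_tie _ _ _ k j kj); [|exact: rowcomb_unit|].
    by rewrite !mxE eqxx (negPf kj) tk.
  by rewrite !vmat_rowcomb !det_rowcomb// dq mulrCA.
have ki : k != i by rewrite eq_sym.
apply: (@excess_half_tie _ _ _ k i ki); [|exact: rowcomb_unit|].
  by rewrite !mxE eqxx (negPf ki) -tk; ring.
by rewrite !vmat_rowcomb !det_rowcomb// dq mulrCA.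
Qed.

Lemma excess_midpoint p a (i j : 'I_(n + 1)) : i != j -> vmat p \in unitmx ->
  (excess p a [::] = 2^-1 * excess p (valcomb a i j 2^-1) [::]
                   + 2^-1 * excess p (valcomb a j i 2^-1) [::])%R.
Proof.
move=> ij pu; have ji : j != i by rewrite eq_sym.
rewrite {1}(excess_cut a [::] ij half01 pu) /= half_sub; congr (_ + _)%R.
  by apply: excess_half => //; rewrite vmat_rowcomb det_rowcomb.
by apply: excess_half => //; rewrite vmat_rowcomb det_rowcomb.
Qed.

(** Small vertex values epi-converge to zero on the fixed simplex. *)
Lemma excess_near0 p (e : R) : vmat p \in unitmx -> (0 < e)%R ->
  exists2 d : R, (0 < d)%R & forall a, (forall i, `|a ord0 i| <= d)%R ->
    (`|excess p a [::] - excess p 0%R [::]| <= e)%R.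
Proof.
move=> pu e0; apply: contrapT => no.
have H (k : nat) : exists a, (forall i, `|a ord0 i| <= k.+1%:R^-1)%R /\
    (e < `|excess p a [::] - excess p 0%R [::]|)%R.
  apply: contrapT => nk; apply: no; exists (k.+1%:R^-1)%R; first by rewrite invr_gt0.
  by move=> a ak; rewrite leNgt; apply/negP => h; apply: nk; exists a.
have [as_ asP] := choice H.
have ck k := Conv_sc_pwaff (as_ k) [::] pu.
have c0 := Conv_sc_pwaff 0%R [::] pu.
have small k x : simplex p x -> (`|dot (bary p x) (as_ k)| <= k.+1%:R^-1)%R.
  move=> px; have [ak _] := asP k.
  apply: le_trans (ler_norm_sum _ _ _) _.
  rewrite -[leRHS]mul1r -[X in (_ <= X * _)%R](bary_sum x pu) mulr_suml; apply: ler_sum => i _.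
  rewrite normrM (ger0_norm (px i)); apply: ler_wpM2l; [exact: px|exact: ak].
have epi : epi_cvg (fun k => pwaff p (as_ k) [::]) (pwaff p 0%R [::]).
  apply: (epi_cvg_of_minorants (w := fun m x => pwaff p 0%R [::] x + (- m.+1%:R^-1)%R%:E)).
  - by move=> m; have [] := Conv_sc_addc (- m.+1%:R^-1)%R c0.
  - move=> m k x mk; have [px|px] := pselect (simplex p x); last first.
      by rewrite !pwaff_out// leey.
    rewrite !pwaff_in//= dot0r -EFinD lee_fin add0r.
    have := small k x px; rewrite ler_norml => /andP[h _]; apply: le_trans h.
    by rewrite lerN2 lef_pV2 ?posrE// ler_nat ltnS.
  - move=> x r; have [px|px] := pselect (simplex p x); last first.
      by exists 0%N; rewrite pwaff_out// addye// ltry.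
    rewrite pwaff_in//= dot0r lte_fin => r0; have [m rm] := nat_gt (- r^-1)%R.
    exists m; rewrite -EFinD lte_fin add0r ltrNr.
    have nr : (0 < - r)%R by lra.
    rewrite invf_plt ?posrE// -invrN in rm *.
    by apply: lt_le_trans rm _; rewrite ler_nat.
  move=> x r; have [px|px] := pselect (simplex p x); last by rewrite pwaff_out.
  rewrite !pwaff_in//= dot0r lte_fin => r0; have [m rm] := nat_gt (r^-1)%R.
  exists m => // k /= mk; rewrite pwaff_in//= lte_fin.
  apply: le_lt_trans (ler_norm _) _; apply: le_lt_trans (small k x px) _.
  rewrite invf_plt ?posrE//; apply: lt_le_trans rm _.
  by rewrite ler_nat (leq_trans mk).
have /cvgrPdist_lt /(_ e e0) [N _ NP] := Vcont ck c0 epi.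
have := NP N (leqnn N); have [_] := asP N.
rewrite /excess distrC opprB addrA subrK => h1 h2.
by move: (lt_trans h1 h2); rewrite ltxx.
Qed.

(** Values lie in an interval of length [4/3 L] divided into a low part of length
    [1/3 L], a middle part and a high part of length [1/3 L]. The midpoint of a
    low and a high value is in the middle part, so passing to midpoints reduces
    the number of low and high values until one of the kinds is missing and the
    spread is at most [L]. *)
Lemma excess_spread p (e d : R) (L : R) : vmat p \in unitmx ->
  (0 < L)%R ->
  (forall a c, (forall i, c <= a ord0 i <= c + L)%R ->
    (`|excess p a [::] - excess p 0%R [::]| <= e)%R) ->
  forall a c, (forall i, c <= a ord0 i <= c + 4 / 3 * L)%R ->
    (`|excess p a [::] - excess p 0%R [::]| <= e)%R.
Proof.
move=> pu L0 small a c ac.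
pose lo a := [set i | (a ord0 i < c + L / 3)%R]%SET.
pose hi a := [set i | (c + L < a ord0 i)%R]%SET.
have [N] := ubnP (#|lo a| + #|hi a|)%N.
elim: N a ac => // N IH a ac; rewrite ltnS => aN.
have [|lo0] := boolP [forall i, i \notin lo a].
  move=> /forallP lo0; apply: (small a (c + L / 3)%R) => i.
  by have := lo0 i; rewrite inE -leNgt => ->/=; have /andP[_] := ac i; lra.
have [|hi0] := boolP [forall i, i \notin hi a].
  move=> /forallP hi0; apply: (small a c) => i.
  by have := hi0 i; rewrite inE -leNgt => ->; have /andP[->] := ac i.
move: lo0 hi0; rewrite !negb_forall => /existsP[i] /negPn ilo /existsP[j] /negPn jhi.
have ai : (a ord0 i < c + L / 3)%R by move: ilo; rewrite inE.
have aj : (c + L < a ord0 j)%R by move: jhi; rewrite inE.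
have ij : i != j by apply/eqP => E; move: aj; rewrite -E; lra.
have /andP[ci1 ci2] := ac i; have /andP[cj1 cj2] := ac j.
have m1 : (c + L / 3 <= 2^-1 * a ord0 i + 2^-1 * a ord0 j)%R by lra.
have m2 : (2^-1 * a ord0 i + 2^-1 * a ord0 j <= c + L)%R by lra.
have mid (k l : 'I_(n + 1)) m : valcomb a k l 2^-1%R ord0 m =
    (if m == l then 2^-1 * a ord0 k + 2^-1 * a ord0 l else a ord0 m)%R.
  by rewrite mxE half_sub addrC.
have step (k l : 'I_(n + 1)) : (k = i /\ l = j) \/ (k = j /\ l = i) ->
    (`|excess p (valcomb a k l 2^-1) [::] - excess p 0%R [::]| <= e)%R.
  move=> kl.
  have mkl : (2^-1 * a ord0 k + 2^-1 * a ord0 l = 2^-1 * a ord0 i + 2^-1 * a ord0 j)%R.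
    by case: kl => -[-> ->] //; rewrite addrC.
  apply: IH => [m|].
    rewrite mid; case: eqP => _; last exact: ac.
    by rewrite mkl; apply/andP; split; lra.
  have los : lo (valcomb a k l 2^-1%R) \subset lo a.
    apply/fintype.subsetP => m; rewrite !inE mid; case: eqP => // _.
    by rewrite mkl ltNge m1.
  have his : hi (valcomb a k l 2^-1%R) \subset hi a.
    apply/fintype.subsetP => m; rewrite !inE mid; case: eqP => // _.
    by rewrite mkl ltNge m2.
  have nl : l \notin lo (valcomb a k l 2^-1%R).
    by rewrite inE mid eqxx mkl -leNgt.
  have nh : l \notin hi (valcomb a k l 2^-1%R).
    by rewrite inE mid eqxx mkl -leNgt.
  apply: leq_trans aN; case: kl => -[_ lE].
    rewrite -addnS leq_add ?subset_leq_card//; apply: proper_card.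
    by apply/properP; split=> //; exists l => //; rewrite lE.
  rewrite -addSn leq_add ?subset_leq_card//; apply: proper_card.
  by apply/properP; split=> //; exists l => //; rewrite lE.
rewrite (excess_midpoint a ij pu).
have := step i j (or_introl (conj erefl erefl)).
have := step j i (or_intror (conj erefl erefl)).
rewrite !ler_norml => /andP[h1 h2] /andP[h3 h4]; apply/andP; split; lra.
Qed.

(** Near-equal vertex values change the excess by at most [e] up to a shift;
    excess_spread enlarges the admissible spread by [4/3] at each step
    without losing in [e]. *)
Lemma excess_affine_cst p a : vmat p \in unitmx -> excess p a [::] = excess p 0%R [::].
Proof.
move=> pu; apply/eqP; rewrite -subr_eq0 -normr_le0; apply/ler_addgt0Pr => e e0.
rewrite add0r; have [d d0 small] := excess_near0 pu e0.
have base b c : (forall i, c <= b ord0 i <= c + d)%R ->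
    (`|excess p b [::] - excess p 0%R [::]| <= e)%R.
  move=> bc; rewrite -(excess_shift b (- c) pu); apply: small => i.
  rewrite !mxE ler_norml; have /andP[h1 h2] := bc i; apply/andP; split; lra.
have Lpos (k : nat) : (0 < (4 / 3) ^+ k * d)%R.
  by rewrite mulr_gt0// exprn_gt0//; lra.
have all_k (k : nat) b c : (forall i, c <= b ord0 i <= c + (4 / 3) ^+ k * d)%R ->
    (`|excess p b [::] - excess p 0%R [::]| <= e)%R.
  elim: k b c => [|k IH] b c; first by rewrite expr0 mul1r; exact: base.
  rewrite exprS -mulrA; exact: (excess_spread d pu (Lpos k) IH).
have [k ak] : exists k : nat, (`|a| + `|a| <= (4 / 3) ^+ k * d)%R.
  have [m ma] := nat_gt ((`|a| + `|a|) / d * 3)%R; exists m.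
  rewrite -ler_pdivrMr//.
  (* Bernoulli's inequality *)
  have bern (r : nat) : (r%:R / 3 <= (4 / 3) ^+ r :> R)%R.
    have : (1 + r%:R / 3 <= (4 / 3) ^+ r :> R)%R.
      elim: r => [|r IHr]; first by rewrite expr0 mul0r addr0.
      rewrite exprS -natr1; have r0 : (0 <= r%:R :> R)%R by [].
      by nra.
    by lra.
  by apply: le_trans (bern m); rewrite ler_pdivlMr// ltW.
apply: (all_k k a (- `|a|)%R) => i.
have := coord_le_norm a i; rewrite ler_norml => /andP[-> h]/=.
by apply: le_trans h _; rewrite addrC -lerBlDr opprK.
Qed.

(** With value [k] at one vertex and [0] at the others the excess is the same for
    all [k], while the functions epi-converge to the indicator of a facet. *)
Lemma excess_affine0 p a : vmat p \in unitmx -> excess p a [::] = 0%R.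
Proof.
move=> pu; rewrite excess_affine_cst//.
have n3 : (3 <= n + 1)%N by rewrite addn1.
pose i : 'I_(n + 1) := Ordinal (ltnW (ltnW n3)).
pose j : 'I_(n + 1) := Ordinal (ltnW n3).
have ij : i != j by [].
pose f x := dot (bary p x) (delta_mx ord0 i).
have af : affine_fun f := bary_affine_fun p _.
have cs := Conv_sc_indic_simplex pu.
have sj := simplex_vertex j pu.
have fj : f (row j p) = 0%R by rewrite /f dot_delta bary_vertex// mxE (negPf ij) andbF.
have fi : f (row i p) = 1%R by rewrite /f dot_delta bary_vertex// mxE !eqxx.
have E k : pwaff p (k%:R *: delta_mx ord0 i)%R [::] =
    (fun x => indic (simplex p) x + (k%:R * `|f x|)%:E).
  apply/funext => x; have [px|px] := pselect (simplex p x); last first.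
    by rewrite pwaff_out// indic_out// addye.
  by rewrite pwaff_in//= indic_in// add0e dotZr ger0_norm// /f dot_delta px.
have cf : Conv_sc (restrict (indic (simplex p)) [set x | f x = 0%R]).
  apply: (Conv_sc_restrict (x0 := row j p)) => //; first exact: affine_closed_eq.
    exact: affine_convex_eq.
  by rewrite indic_in.
have [d [b fE]] := bary_affine p (delta_mx ord0 i).
have Vf : V (restrict (indic (simplex p)) [set x | f x = 0%R]) = atom.
  apply: (@valuation_hyperplane _ d b) => //.
    apply/eqP => d0; have : f (row i p) = f (row j p) by rewrite /f !fE d0 !dot0r.
    by rewrite fi fj => /eqP; rewrite oner_eq0.
  move=> x; have [fx|fx] := pselect (f x = 0%R); first by rewrite -fE.
  by rewrite restrict_out ?eqxx// indic_noNy.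
have := Vcont (fun k => Conv_sc_add_norm cs (ler0n R k) af) cf (epi_cvg_add_norm cs af).
have Vk k : V (fun x => indic (simplex p) x + (k%:R * `|f x|)%:E) = V (pwaff p 0%R [::]).
  have := excess_affine_cst (k%:R *: delta_mx ord0 i)%R pu.
  by rewrite /excess E => /(congr1 (fun r => r + atom)%R); rewrite !subrK.
under eq_fun do rewrite Vk.
rewrite Vf => /cvg_lim; rewrite lim_cst// => h.
by rewrite /excess h// subrr.
Qed.

Lemma dot_simplex_le p x a b : simplex p x -> (forall i, a ord0 i <= b ord0 i)%R ->
  (dot (bary p x) a <= dot (bary p x) b)%R.
Proof.
by move=> px ab; apply: ler_sum => i _; apply: ler_wpM2l; [exact: px|exact: ab].
Qed.

Lemma maxaff_swap a b (al : seq 'rV[R]_(n + 1)) l : (dot l a <= dot l b)%R ->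
  Num.max (dot l b) (maxaff a al l) = maxaff b al l.
Proof.
by move=> ab; elim: al => [|c al IH] /=; [rewrite max_l | rewrite maxCA IH].
Qed.

Lemma pwaff_drop p a b al : (forall i, b ord0 i <= a ord0 i)%R ->
  pwaff p a (b :: al) = pwaff p a al.
Proof.
move=> ba; apply/funext => x; have [px|px] := pselect (simplex p x); last first.
  by rewrite !pwaff_out.
rewrite !pwaff_in//= max_r// (le_trans _ (maxaff_ge _ _ _))//.
exact: dot_simplex_le.
Qed.

Lemma pwaff_swap p a b al : (forall i, a ord0 i <= b ord0 i)%R ->
  pwaff p a (b :: al) = pwaff p b al.
Proof.
move=> ab; apply/funext => x; have [px|px] := pselect (simplex p x); last first.
  by rewrite !pwaff_out.
by rewrite !pwaff_in//= maxaff_swap// dot_simplex_le.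
Qed.

(** If two of the affine functions are ordered at all vertices, one of them can
    be dropped. Otherwise some edge joins vertices with opposite order; cutting
    it where the functions agree makes the number of strictly ordered
    vertices smaller on both pieces. *)
Theorem excess0 p a al : vmat p \in unitmx -> excess p a al = 0%R.
Proof.
have [m] := ubnP (size al); elim: m al p a => // m IHm al p a.
case: al => [|b al] /=; first by move=> _; exact: excess_affine0.
rewrite ltnS => alm.
pose pos (a b : 'rV[R]_(n + 1)) := [set i | (b ord0 i < a ord0 i)%R]%SET.
have [N] := ubnP (#|pos a b| + #|pos b a|)%N.
elim: N p a b al alm => // N IHN p a b al alm; rewrite ltnS => abN pu.
have [|pos0] := boolP [forall i, i \notin pos b a].
  move=> /forallP pos0; rewrite /excess pwaff_drop; first exact: IHm.
  by move=> i; have := pos0 i; rewrite inE -leNgt.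
have [|neg0] := boolP [forall i, i \notin pos a b].
  move=> /forallP neg0; rewrite /excess pwaff_swap; first exact: IHm.
  by move=> i; have := neg0 i; rewrite inE -leNgt.
move: pos0 neg0; rewrite !negb_forall => /existsP[j] /negPn jab /existsP[i] /negPn iab.
have ai : (b ord0 i < a ord0 i)%R by move: iab; rewrite inE.
have aj : (a ord0 j < b ord0 j)%R by move: jab; rewrite inE.
have ij : i != j by apply/eqP => E; move: aj; rewrite -E ltNge ltW.
pose di := (a ord0 i - b ord0 i)%R; pose dj := (a ord0 j - b ord0 j)%R.
have di0 : (0 < di)%R by rewrite subr_gt0.
have dj0 : (dj < 0)%R by rewrite subr_lt0.
pose t := (di / (di - dj))%R.
have t01 : (0 < t < 1)%R.
  apply/andP; split; first by rewrite divr_gt0//; lra.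
  by rewrite ltr_pdivrMr ?mul1r; lra.
have td : (t * dj + (1 - t) * di = 0)%R.
  by rewrite /t; field; apply/eqP; lra.
have t0 : t != 0%R by case/andP: t01 => /gt_eqF ->.
have t1 : (1 - t)%R != 0%R by case/andP: t01 => _ ?; rewrite subr_eq0 gt_eqF.
have step (k l : 'I_(n + 1)) (r : R) q :
    (k = i /\ l = j \/ k = j /\ l = i) ->
    (r * (a ord0 l - b ord0 l) + (1 - r) * (a ord0 k - b ord0 k) = 0)%R ->
    vmat q \in unitmx ->
    excess q (valcomb a k l r) [seq valcomb c k l r | c <- b :: al] = 0%R.
  move=> kl rd qu; rewrite /=.
  have eqvl : valcomb a k l r ord0 l = valcomb b k l r ord0 l.
    by rewrite !mxE eqxx; lra.
  have sub (c d : 'rV[R]_(n + 1)) : valcomb c k l r ord0 l = valcomb d k l r ord0 l ->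
      pos (valcomb c k l r) (valcomb d k l r) \subset pos c d :\ l.
    move=> cdl; apply/fintype.subsetP => x; rewrite !inE.
    have [->|xl] := eqVneq x l; first by rewrite cdl ltxx.
    by rewrite !mxE (negPf xl).
  have s1 := subset_leq_card (sub _ _ eqvl).
  have s2 := subset_leq_card (sub _ _ (esym eqvl)).
  apply: IHN => //; first by rewrite size_map.
  have D1 := cardsD1 l (pos a b); have D2 := cardsD1 l (pos b a).
  have lin : (0 < (l \in pos a b) + (l \in pos b a))%N.
    by case: kl => -[_ ->]; rewrite addn_gt0 ?iab ?jab ?orbT.
  apply: leq_trans abN; rewrite D1 D2 addnACA.
  by rewrite -addn1 addnC leq_add// leq_add.
have ji : j != i by rewrite eq_sym.
rewrite (excess_cut a (b :: al) ij t01 pu).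
rewrite (step i j t _ (or_introl (conj erefl erefl)) td (rowcomb_unit ij t0 pu)).
rewrite (step j i (1 - t)%R _ (or_intror (conj erefl erefl)) _
  (rowcomb_unit ji t1 pu)) ?addr0//.
by rewrite -/di -/dj -td; ring.
Qed.

End constancy.

(** * Approximation by piecewise affine functions *)

Section minorants.
Local Open Scope ereal_scope.
Context {R : realType} {n : nat}.
Implicit Types (u v : 'rV[R]_n -> \bar R) (x y z : 'rV[R]_n).

Lemma dist_convex (s : R) x0 : (0 <= s)%R ->
  convex_fun (fun x => s * dot (x - x0) (x - x0))%R.
Proof.
move=> s0 x y t /andP[t0 t1].
rewrite (mulrCA t) (mulrCA (1 - t))%R -mulrDr ler_wpM2l//.
have -> : (t *: x + (1 - t) *: y - x0 = t *: (x - x0) + (1 - t) *: (y - x0))%R.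
  rewrite !scalerBr addrACA -opprD -scalerDl (_ : t + (1 - t) = 1)%R ?scale1r//.
  by ring.
move: (x - x0)%R (y - x0)%R => a b.
have := dot_ge0 (a - b)%R; rewrite !(dotDl, dotDr, dotNl, dotNr, dotZl, dotZr).
rewrite (dotC b a); set A := dot a a; set B := dot b b; set C := dot a b.
have t1' : (0 <= 1 - t)%R by rewrite subr_ge0.
have tt := mulr_ge0 t0 t1'.
by move=> h; have := mulr_ge0 tt h; nra.
Qed.

(** Replaces the derivative at [0] in the optimality condition of a minimizer. *)
Lemma le0_of_small (A B : R) :
  (forall t, 0 < t <= 1 -> A <= t * B)%R -> (A <= 0)%R.
Proof.
move=> h; rewrite leNgt; apply/negP => A0.
have AB := h 1%R; rewrite ltr01 lexx mul1r in AB; have {}AB := AB isT.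
have B0 : (0 < B)%R by lra.
have := h (A / (2 * B))%R; rewrite divr_gt0 ?mulr_gt0//=.
have -> : (A / (2 * B) * B = A / 2)%R by field; rewrite gt_eqF.
rewrite ler_pdivrMr ?mulr_gt0// mul1r => /(_ _); lra.
Qed.

(** Let [ys] minimize [u + s |y - x0|^2]. The optimality condition says that
    [v - 2 s (ys - x0) . (y - ys)], with [v = u ys], lies below [u y]. Its value at
    [x0] is at least the minimum of [u + s |y - x0|^2], which exceeds [alpha] for
    large [s]: either [ys] is so close to [x0] that [u ys] exceeds [alpha], or
    the quadratic term is large. *)
Lemma Conv_sc_affine_minorant u x0 (alpha : R) : Conv_sc u -> alpha%:E < u x0 ->
  exists z (c : R), (forall y, (dot y z + c)%:E <= u y) /\
    (alpha < dot x0 z + c)%R.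
Proof.
move=> cu au; have /Conv_scP[ul uc _ ug] := cu.
have uN x := Conv_sc_noNy x cu.
have [rho rho0 ball_u] : exists2 rho : R, (0 < rho)%R &
    forall y, (`|x0 - y| < rho)%R -> alpha%:E < u y.
  have /nbhs_ballP[rho /= rho0 hrho] := (lscP u).1 ul _ _ au.
  by exists rho => // y xy; apply: hrho; rewrite -ball_normE.
have [b ub] := ug 0%R.
(* [b + s * rho ^ 2] exceeds [alpha] *)
pose s := ((`|alpha - b| + 1) / rho ^+ 2)%R.
have s0 : (0 < s)%R by rewrite divr_gt0 ?exprn_gt0// ltr_pwDr.
have cw : Conv_sc (fun x => u x + (s * dot (x - x0) (x - x0))%:E).
  apply: Conv_sc_add => //.
  - move=> x; apply: (@continuous_comp _ _ _ (fun x => dot (x - x0) (x - x0))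
      (fun r => s * r)%R x); first exact: dist_continuous.
    by apply: cvgM; [exact: cvg_cst|exact: cvg_id].
  - by apply: dist_convex; exact: ltW.
  exists 0%R, 0%R => x; rewrite mul0r oppr0 addr0 mulr_ge0 ?dot_ge0//.
  exact: ltW.
have [ys [m [wys wmin]]] := Conv_sc_fin_min cw.
have [v uys] : exists v : R, u ys = v%:E.
  by move: wys; case: (u ys) => // r _; exists r.
set d := (ys - x0)%R.
have mE : m = (v + s * dot d d)%R by move: wys; rewrite uys -EFinD => -[->].
pose z := (- (2 * s) *: d)%R.
exists z, (v - dot ys z)%R; split.
  move=> y; case uy : (u y) (uN y) => [r| |] // _; last by rewrite leey.
  rewrite lee_fin; pose e := (y - ys)%R.
  suff : (v - r + dot e z <= 0)%R by rewrite /e dotDl dotNl; lra.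
  apply: (@le0_of_small _ (s * dot e e)%R) => t /andP[t0 t1].
  have t01 : (0 <= t <= 1)%R by rewrite ltW.
  have := uc y ys t t01; rewrite uy uys -!EFinM -EFinD => uct.
  have := le_trans (wmin (t *: y + (1 - t) *: ys)%R) (leeD2r _ uct).
  rewrite -EFinD lee_fin mE.
  have -> : (t *: y + (1 - t) *: ys - x0 = d + t *: e)%R.
    by apply/rowP => i; rewrite !mxE; ring.
  rewrite /z; move: (e) (d) => e' d'.
  rewrite !(dotDl, dotDr, dotZl, dotZr) (dotC e' d').
  set D := dot d' d'; set E := dot e' e'; set F := dot d' e' => h.
  rewrite -(ler_pM2l t0); lra.
have xz : (dot x0 z - dot ys z = 2 * s * dot d d)%R.
  rewrite -dotNl -dotDl (_ : x0 - ys = - d)%R; last by rewrite /d opprB.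
  by rewrite /z dotNl dotZr; ring.
have dd0 := dot_ge0 d.
have sd0 : (0 <= s * dot d d)%R by rewrite mulr_ge0// ltW.
suff : (alpha < v + s * dot d d)%R by lra.
have [near|far] := ltP `|x0 - ys|%R rho.
  have := ball_u ys near; rewrite uys lte_fin; lra.
have bv : (b <= v)%R.
  by have := ub ys; rewrite mul0r add0r uys lee_fin.
have : (rho ^+ 2 <= dot d d)%R.
  apply: le_trans (normsq_le_dot _); rewrite -normrN /d opprB.
  by rewrite lerXn2r ?nnegrE// ltW.
move=> h; have := ler_wpM2l (ltW s0) h.
rewrite {1}/s divfK ?expf_neq0 ?gt_eqF// => h2.
by have := ler_norm (alpha - b)%R; lra.
Qed.

Definition raff (q : 'rV[rat]_n * rat) x : R :=
  (dot x (map_mx ratr q.1) + ratr q.2)%R.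

(** On a bounded domain a slight change of the slope changes an affine function
    little, which is compensated by lowering it. *)
Lemma rational_minorant u x0 (alpha rho : R) : Conv_sc u ->
  (forall y, u y != +oo -> (`|y| <= rho)%R) -> alpha%:E < u x0 ->
  exists q, (forall y, (raff q y)%:E <= u y) /\ (alpha < raff q x0)%R.
Proof.
move=> cu urho /(Conv_sc_affine_minorant cu)[z [c [zc ax0]]].
have uN x := Conv_sc_noNy x cu.
pose eta := ((dot x0 z + c - alpha) / 4)%R.
have eta0 : (0 < eta)%R by rewrite divr_gt0//; lra.
pose B := (`|rho| + `|x0| + 1)%R.
have B0 : (0 < B)%R by rewrite ltr_pwDr// addr_ge0.
pose del := (eta / (n.+1%:R * B))%R.
have del0 : (0 < del)%R by rewrite divr_gt0// mulr_gt0.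
have H (i : 'I_n) : exists r : rat, (`|ratr r - z ord0 i| < del)%R.
  have [|r] := @rat_in_itvoo R (z ord0 i - del)%R (z ord0 i + del)%R; first lra.
  rewrite in_itv /= => /andP[r1 r2]; exists r.
  by rewrite ltr_distl; apply/andP; split.
have [f fP] := choice H.
have [|k] := @rat_in_itvoo R (c - 2 * eta)%R (c - eta)%R; first lra.
rewrite in_itv /= => /andP[k1 k2].
pose q := (\row_i f i, k)%R : 'rV[rat]_n * rat; exists q.
have close y : (`|y| <= B)%R ->
    (`|dot y (map_mx ratr q.1) - dot y z| <= eta)%R.
  move=> yB; rewrite -dotNr -dotDr; apply: le_trans (dot_le_norm _ _) _.
  have : (`|map_mx ratr q.1 - z| <= del)%R.
    apply: norm_le_coord; first exact: ltW.
    by move=> i; rewrite !mxE ltW.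
  move=> h; apply: (@le_trans _ _ (n.+1%:R * del * B)%R).
    by rewrite ler_pM ?mulr_ge0// ler_pM// ler_nat.
  by rewrite /del mulrAC mulrC divfK// mulf_neq0 ?gt_eqF// pnatr_eq0.
split.
  move=> y; case uy : (u y) (uN y) => [r| |] // _; last by rewrite leey.
  have yB : (`|y| <= B)%R.
    have : (`|y| <= rho)%R by apply: urho; rewrite uy.
    have := ler_norm rho; have := normr_ge0 x0; rewrite /B; lra.
  apply: le_trans (_ : (dot y z + c)%:E <= _); last by rewrite -uy.
  have := close y yB; rewrite ler_distl => /andP[_ h].
  by rewrite lee_fin /raff /=; lra.
have x0B : (`|x0| <= B)%R by have := normr_ge0 rho; rewrite /B; lra.
have := close x0 x0B; rewrite ler_distl => /andP[h _].
rewrite /raff /= /eta in h k1 *; lra.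
Qed.

End minorants.

Section density.
Local Open Scope ereal_scope.
Context {R : realType} {n : nat}.
Implicit Types (u v : 'rV[R]_n -> \bar R) (x y z : 'rV[R]_n).
Implicit Types (p : 'M[R]_(n + 1, n)) (a b l : 'rV[R]_(n + 1)).

Definition vertex_values p (q : 'rV[rat]_n * rat) : 'rV[R]_(n + 1) :=
  \row_i raff q (row i p).

Lemma dot_vertex_values p q x : vmat p \in unitmx ->
  dot (bary p x) (vertex_values p q) = raff q x.
Proof.
move=> pu; rewrite /dot; under eq_bigr do rewrite [vertex_values _ _ _ _]mxE mulrDr.
rewrite big_split /= -mulr_suml bary_sum// mul1r; congr (_ + _)%R.
rewrite -[in RHS](bary_mul x pu).
under eq_bigr do rewrite mulr_sumr.
rewrite exchange_big /=; apply: eq_bigr => j _.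
rewrite [in RHS]mxE mulr_suml; apply: eq_bigr => i _.
by rewrite [row _ _ _ _]mxE mulrA.
Qed.

Lemma maxaff_mem a b al l : b \in al -> (dot l b <= maxaff a al l)%R.
Proof.
elim: al => // c al IH; rewrite inE => /orP[/eqP ->|/IH h] /=.
  by rewrite le_max lexx.
by rewrite le_max h orbT.
Qed.

Lemma maxaff_le a al l (M : R) : (dot l a <= M)%R ->
  (forall b, b \in al -> dot l b <= M)%R -> (maxaff a al l <= M)%R.
Proof.
move=> aM; elim: al => [|c al IH] //= h; rewrite ge_max h ?inE ?eqxx//=.
by apply: IH => b bal; apply: h; rewrite inE bal orbT.
Qed.

Lemma maxaff_cat a s al l : (maxaff a al l <= maxaff a (s ++ al) l)%R.
Proof. by elim: s => [|b s IH] //=; rewrite le_max IH orbT. Qed.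

Definition minorant u (q : 'rV[rat]_n * rat) := forall y, (raff q y)%:E <= u y.

(** An enumeration of the rational affine minorants of [u], with repetition of
    the empty list at the other codes. *)
Definition minorant_at u (k : nat) : seq ('rV[rat]_n * rat) :=
  if unpickle k is Some q then if `[< minorant u q >] then [:: q] else [::] else [::].

Fixpoint minorants u (k : nat) : seq ('rV[rat]_n * rat) :=
  if k is k'.+1 then minorant_at u k' ++ minorants u k' else [::].

Lemma minorants_sound u k q : q \in minorants u k -> minorant u q.
Proof.
elim: k => //= k IH; rewrite mem_cat => /orP[|/IH//].
rewrite /minorant_at; case: unpickle => // q'; case: asboolP => // m.
by rewrite inE => /eqP ->.
Qed.

Lemma minorants_complete u q : minorant u q -> q \in minorants u (pickle q).+1.
Proof.
move=> m /=; rewrite mem_cat /minorant_at pickleK.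
by case: asboolP => // _; rewrite inE eqxx.
Qed.

Lemma minorants_mono u k k' : (k <= k')%N ->
  exists s, minorants u k' = s ++ minorants u k.
Proof.
move=> /subnK <-; elim: (k' - k)%N => [|m [s IH]]; first by exists [::].
by exists (minorant_at u (m + k) ++ s); rewrite addSn /= IH catA.
Qed.

Lemma epi_cvg_pwaff u p : Conv_sc u -> vmat p \in unitmx ->
  (forall x, u x != +oo -> simplex p x) ->
  epi_cvg (fun k => pwaff p (const_mx (minval u))
                      [seq vertex_values p q | q <- minorants u k]) u.
Proof.
move=> cu pu up; have [_ [_ um]] := minvalP cu.
have uN x := Conv_sc_noNy x cu.
have cst x : dot (bary p x) (const_mx (minval u)) = minval u.
  have cE i : (const_mx (minval u) : 'rV[R]_(n + 1)) ord0 i = minval u by rewrite mxE.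
  rewrite /dot; under eq_bigr do rewrite cE.
  by rewrite -mulr_suml bary_sum// mul1r.
apply: epi_cvg_below.
- by move=> m; have [] := Conv_sc_pwaff (const_mx (minval u))
    [seq vertex_values p q | q <- minorants u m] pu.
- move=> m k x mk; have [px|px] := pselect (simplex p x); last first.
    by rewrite !pwaff_out.
  rewrite !pwaff_in// lee_fin; have [s ->] := minorants_mono u mk.
  by rewrite map_cat maxaff_cat.
- move=> k x; case ux : (u x) (uN x) => [r| |] // _; last by rewrite leey.
  rewrite pwaff_in; last by apply: up; rewrite ux.
  rewrite lee_fin; apply: maxaff_le => [|b /mapP[q qm ->]].
    by rewrite cst -lee_fin -ux.
  by rewrite dot_vertex_values// -lee_fin -ux; exact: minorants_sound qm _.
move=> x r; have [px|px] := pselect (simplex p x); last first.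
  by move=> _; exists 0%N; rewrite pwaff_out// ltry.
have dom y : u y != +oo -> (`|y| <= (n + 1)%:R * `|p|)%R.
  by move=> /up; exact: simplex_bounded.
move=> /(rational_minorant cu dom)[q [qm qr]]; exists (pickle q).+1.
rewrite pwaff_in// lte_fin; apply: lt_le_trans qr _.
rewrite -(dot_vertex_values q x pu); apply: maxaff_mem; apply: map_f.
exact: minorants_complete.
Qed.

(** The simplex with vertices [y] and [y + s e_i], where [y] has all coordinates
    [- rho]; its barycentric coordinates are [(x - y) / s] and the complement of their
    sum to [1]. *)
Lemma big_simplex (rho : R) : (0 <= rho)%R ->
  exists2 p, vmat p \in unitmx & forall x, (`|x| <= rho)%R -> simplex p x.
Proof.
move=> rho0; pose s := (n%:R * (2 * rho) + 1)%R.
have s0 : (0 < s)%R by rewrite ltr_pwDr// mulr_ge0// mulr_ge0.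
pose y : 'rV[R]_n := const_mx (- rho)%R.
pose c : 'M[R]_(n, 1) := const_mx 1%R.
pose p : 'M[R]_(n + 1, n) := col_mx (s%:M + c *m y)%R y.
have one : (const_mx 1 : 'M[R]_1)%R = 1%:M%R.
  by apply/matrixP => k m; rewrite !ord1 !mxE.
have cE : (const_mx 1 : 'M[R]_(n + 1, 1))%R = col_mx c 1%:M.
  by rewrite -one /c; apply/matrixP => k m; rewrite !mxE; case: fintype.split => ?; rewrite mxE.
have pE : vmat p = (block_mx 1%:M c 0 1%:M *m block_mx s%:M 0 y 1%:M)%R.
  rewrite mulmx_block !mul1mx !mul0mx !mulmx1 !add0r.
  by rewrite /vmat cE block_mxEh.
have pu : vmat p \in unitmx.
  rewrite pE unitmx_mul !unitmxE det_ublock det_lblock !det1 !mulr1 unitr1 det_scalar/=.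
  by rewrite unitfE expf_neq0// gt_eqF.
exists p => // x xr.
pose k : 'M[R]_1 := (s^-1 *: (x - y) *m c)%R.
pose l : 'rV[R]_(n + 1) := row_mx (s^-1 *: (x - y))%R (1%:M - k)%R.
have lE : bary p x = l.
  apply: bary_uniq => //; rewrite /l /vmat cE mul_mx_row !mul_row_col; congr row_mx.
    rewrite mulmxDr mulmxA -/k mul_mx_scalar scalerA divff ?gt_eqF// scale1r.
    by rewrite mulmxBl mul1mx addrACA subrr addr0 subrK.
  by rewrite -/k mulmx1 addrC subrK one.
have xi i : (0 <= (x - y) ord0 i <= 2 * rho)%R.
  rewrite !mxE opprK; have := le_trans (coord_le_norm x i) xr.
  by rewrite ler_norml => /andP[? ?]; apply/andP; split; lra.
move=> i; rewrite lE /l; case: (fintype.split_ordP i) => j ->.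
  rewrite row_mxEl mxE; apply: mulr_ge0; first by rewrite invr_ge0 ltW.
  by have /andP[] := xi j.
rewrite row_mxEr !ord1.
have -> : ((1%:M - k) ord0 ord0 = 1 - k ord0 ord0)%R by rewrite !mxE eqxx.
rewrite subr_ge0 /k mxE.
have : (\sum_j (s^-1 *: (x - y)) ord0 j * c j ord0 <= n%:R * (s^-1 * (2 * rho)))%R.
  apply: ler_sum_bound => j'; rewrite [c _ _]mxE mulr1 mxE.
  apply: ler_wpM2l; first by rewrite invr_ge0 ltW.
  by have /andP[] := xi j'.
move=> h; apply: le_trans h _; rewrite mulrCA mulrC ler_pdivrMr// mul1r /s; lra.
Qed.

(** Functions with domain in a simplex are epi-limits of maxima of their
    rational affine minorants; a general function is the epi-limit of its
    restrictions to growing simplices. *)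
Lemma constant_of_pwaff (V : ('rV[R]_n -> \bar R) -> R) (c : R) :
  functional_continuous V ->
  (forall p a al, vmat p \in unitmx -> V (pwaff p a al) = c) ->
  forall u, Conv_sc u -> V u = c.
Proof.
move=> Vcont Vp.
have Vs u p : Conv_sc u -> vmat p \in unitmx ->
    (forall x, u x != +oo -> simplex p x) -> V u = c.
  move=> cu pu up; have := Vcont _ u _ cu (epi_cvg_pwaff cu pu up).
  move=> /(_ (fun k => Conv_sc_pwaff _ _ pu)).
  under eq_fun do rewrite Vp//.
  by move=> /cvg_lim; rewrite lim_cst// => <-.
move=> u cu; have uN x := Conv_sc_noNy x cu.
have [_ _ _ [x1 ux1] _] := cu.
have H (k : nat) : exists p, vmat p \in unitmx /\
    forall x, (`|x| <= `|x1| + k%:R)%R -> simplex p x.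
  by have [|p pu px] := @big_simplex (`|x1| + k%:R)%R; [rewrite addr_ge0|exists p].
have [f fP] := choice H.
pose us (k : nat) := restrict u (simplex (f k)).
have cus k : Conv_sc (us k).
  have [pu px] := fP k; apply: (Conv_sc_restrict (x0 := x1)) => //.
  - exact: simplex_closed.
  - exact: simplex_convex.
  by apply: px; rewrite lerDl.
have Vus k : V (us k) = c.
  have [pu _] := fP k; apply: (Vs _ (f k)) => // x; apply: contra_neqP => xo.
  by rewrite /us restrict_out.
have epi : epi_cvg us u.
  apply: (epi_cvg_of_minorants (w := fun=> u)).
  - by move=> _; case: cu.
  - by move=> _ k x _; exact: restrict_ge.
  - by move=> x r xr; exists 0%N.
  move=> x r xr; have [N xN] := nat_gt `|x|%R; exists N => // k /= Nk.
  rewrite /us restrict_in//; have [_] := fP k; apply.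
  have : (N%:R <= k%:R :> R)%R by rewrite ler_nat.
  by have := normr_ge0 x1; lra.
have := Vcont us u cus cu epi.
under eq_fun do rewrite Vus.
by move=> /cvg_lim; rewrite lim_cst// => <-.
Qed.

End density.

(** * Valuations satisfying the translation equations *)

Section necessity.
Context {R : realType} {n : nat} (n_ge3 : (3 <= n)%N).
Context {Z : transform R n} {eps : R} {A : 'rV[R]_n -> 'rV[R]_n}.
Context (Zcont : epi_continuous Z) (Zsl : SL_contravariant Z).
Context (Zval : valuation Z) (Ztr : translation_equations Z eps A).
Implicit Types (u : 'rV[R]_n -> \bar R) (x y z : 'rV[R]_n).

Let i0 : 'I_n := Ordinal (ltnW (ltnW n_ge3)).
Let e0 : 'rV[R]_n := delta_mx ord0 i0.

Lemma mxact_invmx (Q : 'M[R]_n) : mxact (invmx (invmx Q^T)) = fun x => x *m Q.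
Proof. by apply/funext => x; rewrite /mxact invmxK trmxK. Qed.

Lemma det1_unit (Q : 'M[R]_n) : \det Q = 1 -> Q \in unitmx.
Proof. by move=> dQ; rewrite unitmxE dQ unitr1. Qed.

Lemma Conv_sc_mulmx u (Q : 'M[R]_n) : Q \in unitmx -> Conv_sc u ->
  Conv_sc (fun x => u (x *m Q)).
Proof.
move=> Qu /(@Conv_sc_comp _ _ u Q 0 Qu).
by under eq_fun do rewrite addr0.
Qed.

Lemma Z_mulmx u (Q : 'M[R]_n) x : Conv_sc u -> \det Q = 1 ->
  Z (fun z => u (z *m Q)) x = Z u (x *m (invmx Q)^T).
Proof.
move=> cu dQ.
have := Zsl cu (phi := invmx Q^T) _ x; rewrite det_inv det_tr dQ invr1 => /(_ erefl).
by rewrite mxact_invmx /mxact !trmxK trmx_inv.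
Qed.

(** Both sides are read off from [Z] at the translate of [u] by [y], composed
    with the inverse of [Q]. *)
Lemma translation_equivariant (Q : 'M[R]_n) : \det Q = 1 ->
  forall y, A (y *m Q) = A y *m Q.
Proof.
move=> dQ y; have Qu := det1_unit dQ; pose u := indic [set (0 : 'rV[R]_n)].
have cu : Conv_sc u := Conv_sc_indic1 0.
have dQi : \det (invmx Q) = 1 by rewrite det_inv dQ invr1.
have Qiu := det1_unit dQi.
have cuQ := Conv_sc_mulmx Qiu cu.
have E x : dot x (A (y *m Q)) = dot x (A y *m Q).
  have [] := Ztr cuQ (y *m Q) x; rewrite Z_mulmx// invmxK => h _.
  have E1 : translate (y *m Q) (fun z => u (z *m invmx Q)) =
      (fun z => translate y u (z *m invmx Q)).
    by apply/funext => z; rewrite /translate mulmxBl mulmxK.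
  have := Z_mulmx x (Conv_sc_translate y cu) dQi.
  rewrite invmxK -E1 h; have [-> _] := Ztr cu y (x *m Q^T).
  by move=> /addrI; rewrite /ell dot_mulmx trmxK.
by apply/rowP => j; have := E (delta_mx ord0 j); rewrite dotC dot_delta dotC dot_delta.
Qed.

Context {sigma : R} (Asigma : forall y, A y = sigma *: y).

Lemma Z_translate u y x : Conv_sc u -> Z (translate y u) x = Z u x + sigma * dot x y.
Proof. by move=> cu; have [-> _] := Ztr cu y x; rewrite /ell Asigma dotZr. Qed.

Lemma Z_addlin u y x : Conv_sc u -> Z (addlin u y) x = Z u (x - eps *: y).
Proof. by move=> cu; have [_ ->] := Ztr cu y x. Qed.

Lemma addlinK u y : (forall x, u x != -oo%E) -> addlin (addlin u (- y)) y = u.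
Proof.
move=> uN; apply/funext => x.
by rewrite /addlin -addeA -EFinD /ell dotNr addNr adde0.
Qed.

(** Compare the two ways of computing [Z] at [translate y v + ell e0], where
    [v = u - ell e0] and [y . e0 = t]. *)
Lemma Z_addc u (t : R) x : Conv_sc u ->
  Z (fun z => (u z + t%:E)%E) x = Z u x - eps * sigma * t.
Proof.
move=> cu; have uN z := Conv_sc_noNy z cu.
have [v cv uv] : exists2 v, Conv_sc v & addlin v e0 = u.
  by exists (addlin u (- e0)); [exact: Conv_sc_addlin | exact: addlinK].
have [y ye] : exists y, dot y e0 = t.
  by exists (t *: e0); rewrite dotZl dot_delta mxE !eqxx mulr1.
have E : addlin (translate y v) e0 = translate y (fun z => (u z + t%:E)%E).
  apply/funext => z; rewrite -uv /addlin /translate -addeA -EFinD.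
  by congr (_ + _%:E)%E; rewrite /ell dotDl dotNl ye subrK.
have := Z_addlin e0 x (Conv_sc_translate y cv).
rewrite E (Z_translate _ _ (Conv_sc_addc t cu)) (Z_translate _ _ cv) -(Z_addlin e0 x cv) uv dotDl dotNl dotZl.
rewrite (dotC e0) ye; lra.
Qed.

Lemma indic_translate (p : 'rV[R]_n) : indic [set p] = translate p (indic [set 0]).
Proof.
apply/funext => z; rewrite /translate; have [->|zp] := pselect (z = p).
  by rewrite subrr !indic_in.
rewrite !indic_out//= => /eqP; rewrite subr_eq0 => /eqP; exact: zp.
Qed.

(** All values of [Z] come from those at indicators of points; a ball contains
    both the origin and [e0], so these two points give the same value at [e0],
    which forces [sigma = 0]. *)
Lemma necessity_eps0 : eps = 0 -> exists c c',
  sigma = 0 /\ representation Z eps sigma c c'.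
Proof.
move=> eps0; pose f := Z (indic [set (0 : 'rV[R]_n)]).
have point x u p : Conv_sc u -> u p != +oo%E -> Z u x = f x + sigma * dot x p.
  move=> cu up; rewrite /f -Z_translate -?indic_translate; last exact: Conv_sc_indic1.
  apply: (@affine_invariant_point _ _ (fun u => Z u x)) => //.
  - by move=> v w cv cw cM cm; exact: Zval.
  - by move=> us v cus cv usv; exact: Zcont.
  - by move=> v a cv; rewrite Z_addlin// eps0 scale0r subr0.
  - by move=> v b cv; rewrite Z_addc// eps0 !mul0r subr0.
have sigma0 : sigma = 0.
  pose B := [set x : 'rV[R]_n | `|x| <= 1].
  have cB : Conv_sc (indic B).
    apply: (@Conv_sc_indic _ _ _ 0 1) => //; last by rewrite /B /= normr0.
      have -> : B = Num.norm @^-1` [set r | r <= 1] by [].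
      by apply: closed_comp; [move=> x _; exact: norm_continuous | exact: closed_le].
    move=> x y t /andP[t0 t1] xB yB; rewrite /B /=.
    have t1' : 0 <= 1 - t by rewrite subr_ge0.
    apply: le_trans (ler_normD _ _) _; rewrite !normrZ (ger0_norm t0) (ger0_norm t1').
    have := ler_wpM2l t0 xB; have := ler_wpM2l t1' yB; lra.
  have B0 : B 0 by rewrite /B /= normr0.
  have Be : B e0.
    apply: norm_le_coord => // i; rewrite mxE.
    by case: (_ && _); rewrite ?normr1 ?normr0.
  have h0 : Z (indic B) e0 = f e0 + sigma * dot e0 0.
    by apply: point => //; rewrite indic_in.
  have : Z (indic B) e0 = f e0 + sigma * dot e0 e0.
    by apply: point => //; rewrite indic_in.
  by rewrite h0 dot0r dot_delta mxE !eqxx mulr0 mulr1 => /addrI.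
have fE u x : Conv_sc u -> Z u x = f x.
  by move=> cu; have [_ _ _ [p up] _] := cu; rewrite (point x u p)// sigma0 mul0r addr0.
have fQ (Q : 'M[R]_n) x : \det Q = 1 -> f (x *m Q) = f x.
  move=> dQ; have c0 := Conv_sc_indic1 (0 : 'rV[R]_n).
  have dQ' : \det (invmx Q)^T = 1 by rewrite det_tr det_inv dQ invr1.
  have E : (invmx (invmx Q)^T)^T = Q by rewrite trmx_inv trmxK invmxK.
  have := Z_mulmx x c0 dQ'; rewrite E -/f => <-.
  by rewrite fE//; apply: Conv_sc_mulmx => //; exact: det1_unit.
have [j [ji _]] := ord_avoid2 i0 i0 n_ge3.
exists (f e0), (f 0 - f e0); split=> // u cu x; rewrite eps0 eqxx /= fE//.
congr EFin; rewrite /delta0; have [->|x0] := eqVneq x 0; first by rewrite mulr1 subrK.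
rewrite mulr0 add0r; have [|Q dQ <-] := @SL_transitive _ _ i0 j x _ x0.
  by rewrite eq_sym.
exact: fQ.
Qed.

(** Adding [eps * sigma * minval u] cancels the effect of adding
    constants on [Z u 0]. Once [V] is known to be constant, the value of [Z u] at
    [x] is that of [Z (u - ell (x / eps))] at the origin. *)
Lemma necessity_eps_neq0 : eps != 0 -> exists c, representation Z eps sigma c 0.
Proof.
move=> epsN0; pose V u := Z u 0 + eps * sigma * minval u.
have VE u : Conv_sc u -> V u = atom (V := V).
  apply: constant_of_pwaff => [us v cus cv usv|p a al pu].
    apply: cvgD; first exact: Zcont.
    by apply: cvgM; [exact: cvg_cst | exact: minval_cvg].
  suff /eqP : excess (V := V) p a al = 0 by rewrite /excess subr_eq0 => /eqP.
  apply: excess0 => //; first exact: ltnW.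
  - move=> v w cv cw cM cm; rewrite /V.
    have := Zval cv cw cM cm 0; have := minval_valuation cv cw cM cm.
    move=> h1 h2; rewrite addrACA h2 -mulrDr h1; ring.
  - move=> us v cus cv usv; apply: cvgD; first exact: Zcont.
    by apply: cvgM; [exact: cvg_cst | exact: minval_cvg].
  - move=> v Q cv dQ; rewrite /V Z_mulmx// mul0mx; congr (_ + _ * _).
    rewrite -[RHS](@minval_comp _ _ v (fun x => x *m Q))// => y.
    by exists (y *m invmx Q); rewrite mulmxKV// det1_unit.
  - move=> v y cv; rewrite /V (_ : (fun x => v (x + y)) = translate (- y) v); last first.
      by apply/funext => x; rewrite /translate opprK.
    rewrite Z_translate// dotC dot0r mulr0 addr0; congr (_ + _ * _).
    rewrite -[RHS](@minval_comp _ _ v (fun x => x - - y))// => z.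
    by exists (z - y); rewrite opprK subrK.
  - by move=> v b cv; rewrite /V Z_addc// minval_addc//; ring.
exists (atom (V := V)) => u cu x; rewrite epsN0 legendreE// -EFinM -EFinD.
congr EFin; pose w := eps^-1 *: x.
have ca : Conv_sc (addlin u (- w)) := Conv_sc_addlin _ cu.
have := VE _ ca; rewrite /V Z_addlin// sub0r scalerN opprK /w scalerA divff// scale1r.
by move=> <-; ring.
Qed.

End necessity.

(** * The classification *)

Theorem theorem5p2 (R : realType) (n : nat) (n_ge3 : (3 <= n)%N)
    (Z : transform R n) :
  (forall (eps : R) (A : 'rV[R]_n -> 'rV[R]_n),
     epi_continuous Z /\ SL_contravariant Z /\ valuation Z /\
       translation_equations Z eps A ->
     exists c c' sigma : R,
       (forall y, A y = sigma *: y) /\ representation Z eps sigma c c') /\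
  (forall (eps : R) (A : 'rV[R]_n -> 'rV[R]_n),
     (exists c c' sigma : R,
       (forall y, A y = sigma *: y) /\ representation Z eps sigma c c') ->
     epi_continuous Z /\ SL_contravariant Z /\ valuation Z /\
       exists A' : 'rV[R]_n -> 'rV[R]_n,
         (eps <> 0 -> A' = A) /\ translation_equations Z eps A').
Proof.
split=> eps A.
  move=> [Zcont [Zsl [Zval Ztr]]].
  have [sigma As] := SL_equivariant_scalar n_ge3 (translation_equivariant Zsl Ztr).
  have [eps0|eps0] := eqVneq eps 0.
    have [c [c' [_ rep]]] := necessity_eps0 n_ge3 Zcont Zsl Zval Ztr As eps0.
    by exists c, c', sigma.
  have [c rep] := necessity_eps_neq0 n_ge3 Zcont Zsl Zval Ztr As eps0.
  by exists c, 0, sigma.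
move=> [c [c' [sigma [As rep]]]].
split; first exact: representation_epi_continuous rep.
split; first exact: representation_SL_contravariant rep.
split; first exact: representation_valuation rep.
have [A' [A'E A'tr]] := representation_translation rep.
exists A'; split=> // eps0; rewrite A'E//.
by apply/funext => y; rewrite As.
Qed.
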